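(* Let $\theta>0$, $\theta\ne1$, let $M\ge1$ and $N\ge2$ be integers, and let $\mathbb P^\theta_N$ be the complex measure of total mass one described in the context, with non-vanishing weights $w,\tau$. Let $\mathcal M\subseteq\mathbb C$ be open with $[0,M+1+(N-1)\theta]\subset\mathcal M$. Suppose there exist six functions $\phi^t_i,\phi^b_i,\phi^m_i$, $i=1,2$, analytic in $\mathcal M$, such that $$\frac{\phi_1^t(z)}{\phi_1^m(z)}=\frac{w(z-1)}{w(z)},\quad \frac{\phi_1^b(\hat z)}{\phi_1^m(\hat z)}=\frac{\tau(\hat z)}{\tau(\hat z-1)},\quad \frac{\phi_2^t(z)}{\phi_2^m(z)}=\frac{w(z)}{w(z-1)},\quad \frac{\phi_2^b(\hat z-\theta)}{\phi_2^m(\hat z-\theta)}=\frac{\tau(\hat z-1)}{\tau(\hat z)}$$ for all $z\in[1,M+(N-1)\theta]$ and $\hat z\in[\theta+1,M+(N-1)\theta]$. Put $s_N=M+1+(N-1)\theta$ and define $$R_1(z)=\phi_1^t(z)\,\mathbb E\Big[\prod_{i=1}^N\tfrac{z-\ell_i-\theta}{z-\ell_i}\Big]+\phi_1^b(z)\,\mathbb E\Big[\prod_{i=1}^{N-1}\tfrac{z-m_i+\theta-1}{z-m_i-1}\Big]+\tfrac{\theta}{1-\theta}\phi_1^m(z)\,\mathbb E\Big[\prod_{i=1}^N\tfrac{z-\ell_i-\theta}{z-\ell_i-1}\prod_{i=1}^{N-1}\tfrac{z-m_i+\theta-1}{z-m_i}\Big]-\frac{r_1^-(N)}z-\frac{r_1^+(N)}{z-s_N},$$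 $$R_2(z)=\phi_2^t(z)\,\mathbb E\Big[\prod_{i=1}^N\tfrac{z-\ell_i+\theta-1}{z-\ell_i-1}\Big]+\phi_2^b(z)\,\mathbb E\Big[\prod_{i=1}^{N-1}\tfrac{z-m_i}{z-m_i+\theta}\Big]+\tfrac{\theta}{1-\theta}\phi_2^m(z)\,\mathbb E\Big[\prod_{i=1}^N\tfrac{z-\ell_i+\theta-1}{z-\ell_i}\prod_{i=1}^{N-1}\tfrac{z-m_i}{z-m_i+\theta-1}\Big]-\frac{r_2^-(N)}z-\frac{r_2^+(N)}{z-s_N},$$ where $$r_1^-(N)=\phi_1^t(0)\,(-\theta)\,\mathbb P^\theta_N(\ell_N=0)\,\mathbb E\Big[\prod_{i=1}^{N-1}\tfrac{\ell_i+\theta}{\ell_i}\,\Big|\,\ell_N=0\Big],$$ $$r_1^+(N)=\phi_1^m(s_N)\,\theta\,\mathbb P^\theta_N(\ell_1=s_N-1)\,\mathbb E\Big[\prod_{i=2}^N\tfrac{s_N-\ell_i-\theta}{s_N-\ell_i-1}\prod_{i=1}^{N-1}\tfrac{s_N-m_i+\theta-1}{s_N-m_i}\,\Big|\,\ell_1=s_N-1\Big]+\phi_1^b(s_N)\,\theta\,\mathbb P^\theta_N(m_1=s_N-1)\,\mathbb E\Big[\prod_{i=2}^{N-1}\tfrac{s_N-m_i+\theta-1}{s_N-m_i-1}\,\Big|\,m_1=s_N-1\Big],$$ $$r_2^-(N)=\phi_2^b(0)\,(-\theta)\,\mathbb P^\theta_N(m_{N-1}=\theta)\,\mathbb E\Big[\prod_{i=1}^{N-2}\tfrac{m_i}{m_i-\theta}\,\Big|\,m_{N-1}=\theta\Big]+\phi_2^m(0)\,(-\theta)\,\mathbb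 P^\theta_N(\ell_N=0)\,\mathbb E\Big[\prod_{i=1}^{N-1}\tfrac{\ell_i-\theta+1}{\ell_i}\prod_{i=1}^{N-1}\tfrac{m_i}{m_i-\theta+1}\,\Big|\,\ell_N=0\Big],$$ $$r_2^+(N)=\phi_2^t(s_N)\,\theta\,\mathbb P^\theta_N(\ell_1=s_N-1)\,\mathbb E\Big[\prod_{i=2}^N\tfrac{s_N-\ell_i+\theta-1}{s_N-\ell_i-1}\,\Big|\,\ell_1=s_N-1\Big].$$ Then $R_1(z)$ and $R_2(z)$ are analytic in $\mathcal M$ (i.e. all their apparent poles are removable).
   Context: **The measure.** For integers $N\ge2$, $M\ge1$ and $\theta>0$, let $\mathfrak X^\theta_N$ be the finite set of pairs $(\ell,m)$, $\ell=(\ell_1,\dots,\ell_N)$, $m=(m_1,\dots,m_{N-1})$, with $\ell_i=\lambda_i+(N-i)\theta$, $m_i=\mu_i+(N-i)\theta$, where $\lambda_i,\mu_i\in\mathbb Z$ and $M\ge\lambda_1\ge\mu_1\ge\lambda_2\ge\cdots\ge\mu_{N-1}\ge\lambda_N\ge0$. Let $w(x)=w(x;N)$ be a complex-valued function, non-zero for $x\in[0,M+(N-1)\theta]$, and $\tau(x)=\tau(x;N)$ a complex-valued function, non-zero for $x\in[\theta,M+(N-1)\theta]$. The complex measure is $$\mathbb P^\theta_N(\ell,m)=Z_N^{-1}H^t(\ell)H^b(m)I(\ell,m),$$ $$H^t(\ell)=\prod_{1\le i<j\le N}\frac{\Gamma(\ell_i-\ell_j+1)}{\Gamma(\ell_i-\ell_j-\theta+1)}\prod_{i=1}^Nw(\ell_i),\qquad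 H^b(m)=\prod_{1\le i<j\le N-1}\frac{\Gamma(m_i-m_j+\theta)}{\Gamma(m_i-m_j)}\prod_{i=1}^{N-1}\tau(m_i),$$ $$I(\ell,m)=\prod_{1\le i<j\le N}\frac{\Gamma(\ell_i-\ell_j-\theta+1)}{\Gamma(\ell_i-\ell_j)}\prod_{1\le i<j\le N-1}\frac{\Gamma(m_i-m_j+1)}{\Gamma(m_i-m_j+\theta)}\prod_{1\le i<j\le N}\frac{\Gamma(m_i-\ell_j)}{\Gamma(m_i-\ell_j-\theta+1)}\prod_{1\le i\le j\le N-1}\frac{\Gamma(\ell_i-m_j+\theta)}{\Gamma(\ell_i-m_j+1)},$$ where the normalization constant $Z_N$ (the sum of $H^tH^bI$ over $\mathfrak X^\theta_N$) is assumed non-zero, so the total mass is one. $\mathbb E[F]=\sum_{(\ell,m)}F(\ell,m)\mathbb P^\theta_N(\ell,m)$, and a product $\mathbb P^\theta_N(A)\,\mathbb E[F\mid A]$ means $\mathbb E[F\,\mathbf 1_A]$. Empty products equal $1$. *)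

(* Defs.v *)
From mathcomp Require Import all_boot all_order all_algebra.
From mathcomp Require Import all_classical all_reals all_analysis.
From mathcomp Require Export complex.
Export numFieldNormedType.Exports.

Set Implicit Arguments.
Unset Strict Implicit.
Unset Printing Implicit Defensive.

Import Order.TTheory GRing.Theory Num.Theory.
Local Open Scope classical_set_scope.
Local Open Scope complex_scope.
Local Open Scope ring_scope.

(* The topology of R[i] is the one attached to its modulus; the library
   provides it on the alias R[i]^o. *)
Definition analytic_in (R : realType) (D : set R[i]^o) (f : R[i]^o -> R[i]^o) :=
  forall z0 : R[i]^o, D z0 ->
    exists a : nat -> R[i]^o,
      \forall z \near z0,
        (\sum_(0 <= k < n) a k * (z - z0) ^+ k) @[n --> \oo] --> f z.

(* P is the (in our uses finite) set of points at which the expression f has a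
   vanishing denominator, where the value f z is the junk value of division
   by 0 and is disregarded. *)
Definition analytic_in_off (R : realType) (D P : set R[i]^o)
    (f : R[i]^o -> R[i]^o) :=
  exists F : R[i]^o -> R[i]^o,
    analytic_in D F /\ (forall z, D z -> ~ P z -> F z = f z).

(* Euler's integral; Gamma is only ever evaluated at positive reals below. *)
Definition Gamma (R : realType) (x : R) : R :=
  \int[lebesgue_measure]_(t in `]0, +oo[) (t `^ (x - 1) * expR (- t)).

(* A configuration stores (lambda_1, ..., lambda_N) and (mu_1, ..., mu_{N-1}),
   which all lie in {0, ..., M}. *)
Definition config (N M : nat) : Type :=
  (N.-tuple 'I_M.+1 * N.-1.-tuple 'I_M.+1)%type.

Section Configurations.
Variables (R : realType) (N M : nat) (theta : R).
Implicit Type c : config N M.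

(* Indices are 1-based: lam c i is lambda_i for 1 <= i <= N and mu c i is mu_i
   for 1 <= i <= N-1. Other indices are not used. *)
Definition lam c (i : nat) : nat := nth ord0 c.1 i.-1.
Definition mu c (i : nat) : nat := nth ord0 c.2 i.-1.

Definition interlacing c : bool :=
  all (fun i => (lam c i.+1 <= mu c i <= lam c i)%N) (iota 1 N.-1).

Definition ell c (i : nat) : R := (lam c i)%:R + (N - i)%:R * theta.
Definition emm c (i : nat) : R := (mu c i)%:R + (N - i)%:R * theta.

Definition sN : R := M%:R + 1 + N.-1%:R * theta.

End Configurations.

Section Measure.
Variables (R : realType) (N M : nat) (theta : R) (w tau : R -> R[i]).
Implicit Type c : config N M.

Local Notation l c := (ell theta c).
Local Notation m c := (emm theta c).

Definition Ht c : R[i] :=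
  (\prod_(1 <= i < N.+1) \prod_(i.+1 <= j < N.+1)
     (Gamma (l c i - l c j + 1) / Gamma (l c i - l c j - theta + 1)))%:C
  * \prod_(1 <= i < N.+1) w (l c i).

Definition Hb c : R[i] :=
  (\prod_(1 <= i < N) \prod_(i.+1 <= j < N)
     (Gamma (m c i - m c j + theta) / Gamma (m c i - m c j)))%:C
  * \prod_(1 <= i < N) tau (m c i).

Definition Itb c : R :=
  (\prod_(1 <= i < N.+1) \prod_(i.+1 <= j < N.+1)
     (Gamma (l c i - l c j - theta + 1) / Gamma (l c i - l c j)))
  * (\prod_(1 <= i < N) \prod_(i.+1 <= j < N)
     (Gamma (m c i - m c j + 1) / Gamma (m c i - m c j + theta)))
  * (\prod_(1 <= i < N.+1) \prod_(i.+1 <= j < N.+1)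
     (Gamma (m c i - l c j) / Gamma (m c i - l c j - theta + 1)))
  * (\prod_(1 <= i < N) \prod_(i <= j < N)
     (Gamma (l c i - m c j + theta) / Gamma (l c i - m c j + 1))).

Definition weight c : R[i] := Ht c * Hb c * (Itb c)%:C.

Definition ZN : R[i] := \sum_(c : config N M | interlacing c) weight c.

Definition prob c : R[i] := ZN^-1 * weight c.

Definition expect (F : config N M -> R[i]) : R[i] :=
  \sum_(c : config N M | interlacing c) F c * prob c.

(* P(A) E[F | A], that is E[F 1_A]. *)
Definition expect_on (A : pred (config N M)) (F : config N M -> R[i]) : R[i] :=
  expect (fun c => F c * (A c)%:R).

End Measure.

Section LoopEquations.
Variables (R : realType) (N M : nat) (theta : R) (w tau : R -> R[i]).
Variables (phit phib phim : R[i]^o -> R[i]^o).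
Implicit Type c : config N M.

Local Notation l c i := ((ell theta c i)%:C).
Local Notation m c i := ((emm theta c i)%:C).
Local Notation th := (theta%:C).
Local Notation s := ((sN N M theta)%:C).
Local Notation E F := (expect theta w tau F).
Local Notation "'E_on' A F" := (expect_on theta w tau A F)
  (at level 10, A at level 8, F at level 8).

Definition ellN_is0 : pred (config N M) := fun c => ell theta c N == 0.
Definition ell1_is_max : pred (config N M) :=
  fun c => ell theta c 1 == sN N M theta - 1.
Definition m1_is_max : pred (config N M) :=
  fun c => emm theta c 1 == sN N M theta - 1.
Definition mlast_is_theta : pred (config N M) :=
  fun c => emm theta c N.-1 == theta.

Definition r1_minus : R[i] :=
  phit 0 * (- th)
  * E_on ellN_is0 (fun c => \prod_(1 <= i < N) ((l c i + th) / l c i)).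

Definition r1_plus : R[i] :=
  phim s * th
  * E_on ell1_is_max (fun c =>
      (\prod_(2 <= i < N.+1) ((s - l c i - th) / (s - l c i - 1)))
      * \prod_(1 <= i < N) ((s - m c i + th - 1) / (s - m c i)))
  + phib s * th
  * E_on m1_is_max (fun c =>
      \prod_(2 <= i < N) ((s - m c i + th - 1) / (s - m c i - 1))).

Definition r2_minus : R[i] :=
  phib 0 * (- th)
  * E_on mlast_is_theta (fun c =>
      \prod_(1 <= i < N.-1) (m c i / (m c i - th)))
  + phim 0 * (- th)
  * E_on ellN_is0 (fun c =>
      (\prod_(1 <= i < N) ((l c i - th + 1) / l c i))
      * \prod_(1 <= i < N) (m c i / (m c i - th + 1))).

Definition r2_plus : R[i] :=
  phit s * th
  * E_on ell1_is_max (fun c =>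
      \prod_(2 <= i < N.+1) ((s - l c i + th - 1) / (s - l c i - 1))).

Definition R1 (z : R[i]^o) : R[i]^o :=
  phit z * E (fun c => \prod_(1 <= i < N.+1) ((z - l c i - th) / (z - l c i)))
  + phib z
    * E (fun c => \prod_(1 <= i < N) ((z - m c i + th - 1) / (z - m c i - 1)))
  + th / (1 - th) * phim z
    * E (fun c =>
        (\prod_(1 <= i < N.+1) ((z - l c i - th) / (z - l c i - 1)))
        * \prod_(1 <= i < N) ((z - m c i + th - 1) / (z - m c i)))
  - r1_minus / z - r1_plus / (z - s).

Definition R2 (z : R[i]^o) : R[i]^o :=
  phit z
    * E (fun c =>
        \prod_(1 <= i < N.+1) ((z - l c i + th - 1) / (z - l c i - 1)))
  + phib z
    * E (fun c => \prod_(1 <= i < N) ((z - m c i) / (z - m c i + th)))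
  + th / (1 - th) * phim z
    * E (fun c =>
        (\prod_(1 <= i < N.+1) ((z - l c i + th - 1) / (z - l c i)))
        * \prod_(1 <= i < N) ((z - m c i) / (z - m c i + th - 1)))
  - r2_minus / z - r2_plus / (z - s).

End LoopEquations.

(* The finitely many zeros of the denominators occurring in R1 and R2. *)
Definition poles1 (R : realType) (N M : nat) (theta : R) : set R[i]^o :=
  [set z | z = 0 \/ z = (sN N M theta)%:C \/
    exists2 c : config N M, interlacing c &
      (exists2 i, (1 <= i <= N)%N &
        z = (ell theta c i)%:C \/ z = (ell theta c i + 1)%:C) \/
      (exists2 i, (1 <= i <= N.-1)%N &
        z = (emm theta c i)%:C \/ z = (emm theta c i + 1)%:C)].

Definition poles2 (R : realType) (N M : nat) (theta : R) : set R[i]^o :=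
  [set z | z = 0 \/ z = (sN N M theta)%:C \/
    exists2 c : config N M, interlacing c &
      (exists2 i, (1 <= i <= N)%N &
        z = (ell theta c i)%:C \/ z = (ell theta c i + 1)%:C) \/
      (exists2 i, (1 <= i <= N.-1)%N &
        z = (emm theta c i - theta)%:C \/
        z = (emm theta c i + 1 - theta)%:C)].

(* Main.v *)
Require Import Defs.
From mathcomp Require Import all_boot all_order all_algebra.
From mathcomp Require Import all_classical all_reals all_analysis.
From mathcomp Require Import measurable_realfun.
From mathcomp Require Import ring lra zify.
Import Order.TTheory GRing.Theory Num.Theory.
Local Open Scope classical_set_scope.
Local Open Scope complex_scope.
Local Open Scope ring_scope.

Set Implicit Arguments.
Unset Strict Implicit.
Unset Printing Implicit Defensive.

(** Away from its poles, each of the three products averaged in [R1] is, for a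
    fixed configuration, [1] plus a sum of simple fractions
    ([expansion_top], [expansion_bottom], [expansion_mixed]): the first has its
    poles at the [l_i], the second at the [m_i + 1], the third at the [l_i + 1]
    and at the [m_i].  Their numerators are [resA], [resC], [resB] and [resD].
    Replacing [phi z] by [phi p + (phi z - phi p)] in every fraction
    [phi z / (z - p)], one writes [R1] as a finite linear combination of the
    [phi]'s and of their difference quotients, which extend analytically over
    [p] ([analytic_in_slope]), plus the sum of the residues tested against
    [h p = (z - p)^-1].  So it suffices that the residues cancel, except at [0]
    and [s_N], where [r1_minus] and [r1_plus] remove what is left.

    In the weight of a configuration the Gamma factors of [H^t], [H^b] and [I]
    combine ([red_weight_of_gamma]) into the Vandermonde products of [l] and
    [m] times factors [g (m_i - l_j)] and [g (l_i - m_j + theta)], with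
    [g x = Gamma x / Gamma (x - theta + 1)].  As
    [g (x + 1) / g x = x / (x - theta + 1)], raising one coordinate multiplies
    the weight by an explicit rational function, and the residues cancel in
    pairs of configurations that differ in a unit shift:
    - [l_i = a] in the first product against [l_i = a - 1] in the third
      ([resA_resB], [pair_l]);
    - [m_i = a - 1] in the second against [m_i = a] in the third
      ([resD_resC], [pair_m]);
    - [l_i = m_i = a] in the first against [l_i = m_i = a - 1] in the second
      ([resA_resC], [pair_lm]); these are the configurations for which the
      shift of a single coordinate violates the interlacing.
    The ratios of the [phi]'s compensate the change of [w] and [tau].  When the
    shifted configuration does not interlace, a numerator vanishes and so does
    the residue ([resA_blocked], [resB_blocked], [resC_blocked],
    [resD_blocked]); only the shifts that would leave the range [0..M] survive,
    and they are the boundary terms of [residue_sum].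

    In the third product, [l_(i+1) + 1] and some [m_j] may coincide, but only
    if [lambda_(i+1) = mu_i]; then the factors of [l_(i+1)] and of [m_i]
    multiply to [1] and may be dropped ([partial_fractions_blocked]), after
    which all poles are simple.

    The statement on [R2] is the one on [R1] read backwards: reversing the
    configuration and mapping [z] to [s_N - z] exchanges the two expressions
    ([R1_reverse]). *)

(** * Euler's Gamma function *)

Section GammaIntegral.
Variable R : realType.
Implicit Types (x p t : R) (n : nat).
Notation mu := (@lebesgue_measure R).

(** Euler's integrand and integral, with the exponent shifted: the integral at
    [p] is the value of [Gamma] at [p + 1], as an extended real. *)
Definition gamma_integrand p t : R := t `^ p * expR (- t).

Definition gamma_integral p : \bar R :=
  integral mu (`]0, +oo[%classic : set R) (fun t => (gamma_integrand p t)%:E).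

(** An increasing sequence of compact intervals with union [(0, +oo)]; the
    offset [2] makes the endpoints distinct from the start. *)
Definition exhaustion n : set R := `[n.+2%:R^-1, n.+2%:R]%classic.

Lemma exhaustion_lt n : n.+2%:R^-1 < n.+2%:R :> R.
Proof. by rewrite (@lt_trans _ _ 1) ?invf_lt1 ?ltr1n. Qed.

Lemma bigcup_exhaustion : \bigcup_n exhaustion n = `]0, +oo[%classic.
Proof.
apply/seteqP; split => t.
  move=> [n _]; rewrite /exhaustion/= !in_itv/= andbT => /andP[h _].
  by apply: lt_le_trans h; rewrite invr_gt0.
rewrite /= in_itv/= andbT => t0.
exists (Num.bound t + Num.bound t^-1)%N => //=.
have b1 := archi_boundP (ltW t0).
have tV0 : 0 < t^-1 by rewrite invr_gt0.
have b2 := archi_boundP (ltW tV0).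
rewrite /exhaustion/= in_itv/=; apply/andP; split.
  rewrite -[leRHS]invrK lef_pV2 ?posrE//.
  by rewrite (le_trans (ltW b2))// ler_nat; lia.
by rewrite (le_trans (ltW b1))// ler_nat; lia.
Qed.

Lemma nondecreasing_exhaustion : nondecreasing_seq exhaustion.
Proof.
move=> m n mn; rewrite subsetEset => t; rewrite /exhaustion/= !in_itv/= => /andP[a b].
have mn2 : m.+2%:R <= n.+2%:R :> R by rewrite ler_nat !ltnS.
rewrite (le_trans b mn2) andbT (le_trans _ a)//.
by rewrite lef_pV2 ?posrE.
Qed.

Lemma gamma_integrand_ge0 p t : 0 <= gamma_integrand p t.
Proof. by rewrite mulr_ge0 ?powR_ge0 ?expR_ge0. Qed.

Lemma continuous_powR_pos p t : 0 < t -> {for t, continuous (fun u : R => u `^ p)}.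
Proof.
move=> t0; apply/differentiable_continuous/derivable1_diffP.
by apply: derivable_powR; rewrite in_itv/= andbT.
Qed.

Lemma continuous_expRN t : {for t, continuous (fun u : R => expR (- u))}.
Proof.
apply: continuous_comp; first exact: (@continuousN _ R^o).
exact: continuous_expR.
Qed.

Lemma within_continuous_pos (f : R -> R) n :
  (forall t, 0 < t -> {for t, continuous f}) -> {within exhaustion n, continuous f}.
Proof.
move=> cf; apply/continuous_in_subspaceT => t; rewrite inE/exhaustion/= in_itv/= => /andP[h _].
by apply: cf; apply: lt_le_trans h; rewrite invr_gt0.
Qed.

Lemma measurable_gamma_integrand p (A : set R) : measurable_fun A (gamma_integrand p).
Proof.
apply: (@measurable_funS _ _ _ _ setT) => //; apply: measurable_funM.
  exact: measurable_powR.
by apply: measurableT_comp.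
Qed.

Lemma integral_exhaustion_cvg p :
  (\int[mu]_(t in exhaustion n) (gamma_integrand p t)%:E)%E @[n --> \oo] --> gamma_integral p.
Proof.
rewrite /gamma_integral -bigcup_exhaustion; apply: ge0_nondecreasing_set_cvg_integral.
- exact: nondecreasing_exhaustion.
- by move=> i; apply: measurable_itv.
- by move=> i; apply/measurable_EFinP; exact: measurable_gamma_integrand.
- by move=> i t _; rewrite lee_fin gamma_integrand_ge0.
Qed.


Lemma integrable_exhaustion p n : mu.-integrable (exhaustion n) (fun t => (gamma_integrand p t)%:E).
Proof.
apply: continuous_compact_integrable; first exact: segment_compact.
apply: within_continuous_pos => t t0; apply: continuousM.
  exact: continuous_powR_pos.
exact: continuous_expRN.
Qed.

(** Integration by parts on a compact interval; valid for all real [p], as the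
    interval avoids the singularity at [0]. *)
Lemma Rintegral_exhaustion_parts p n :
  \int[mu]_(t in exhaustion n) gamma_integrand p t =
  (gamma_integrand p n.+2%:R^-1 - gamma_integrand p n.+2%:R)
   + p * \int[mu]_(t in exhaustion n) gamma_integrand (p - 1) t.
Proof.
have dE t : is_derive t (1 : R) (fun u : R => - expR (- u)) (expR (- t)).
  by apply: is_derive_eq; rewrite mulrN1 opprK.
have dP t : 0 < t -> is_derive t (1:R) (fun u => u `^ p) (p * t `^ (p - 1)).
  by move=> t0; exact: is_derive1_powR.
have pos t : t \in `]n.+2%:R^-1, n.+2%:R[ -> 0 < t.
  by rewrite in_itv/= => /andP[h _]; apply: lt_trans h; rewrite invr_gt0.
have i0 : 0 < n.+2%:R^-1 :> R by rewrite invr_gt0.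
have cE t : {for t, continuous (fun u : R => - expR (- u))}.
  by apply: continuousN; exact: continuous_expRN.
rewrite /gamma_integrand.
rewrite (@Rintegration_by_parts R (fun u => u `^ p) (fun u => - expR (- u))
  (fun u => p * u `^ (p - 1)) (fun u => expR (- u)) _ _ (exhaustion_lt n)).
- rewrite !mulrN opprK [RHS]addrC.
  have -> : \int[mu]_(t in exhaustion n) (p * t `^ (p - 1) * - expR (- t)) =
      \int[mu]_(t in exhaustion n) (- p * gamma_integrand (p - 1) t).
    by apply: eq_Rintegral => t _; rewrite /gamma_integrand mulrN mulNr mulrA.
  rewrite RintegralZl; [|exact: measurable_itv|exact: integrable_exhaustion].
  by rewrite /gamma_integrand; ring.
- apply: within_continuous_pos => t t0; apply: continuousM.
    exact: cst_continuous.
  exact: continuous_powR_pos.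
- split.
  + by move=> t /pos t0; have [] := dP _ t0.
  + by apply: cvg_at_right_filter; exact: continuous_powR_pos.
  + by apply: cvg_at_left_filter; apply: continuous_powR_pos.
- by move=> t /pos t0; rewrite derive1E; have [_ ->] := dP _ t0.
- apply: within_continuous_pos => t t0; exact: continuous_expRN.
- split.
  + by move=> t _; have [] := dE t.
  + by apply: cvg_at_right_filter; exact: cE.
  + by apply: cvg_at_left_filter; exact: cE.
- by move=> t _; rewrite derive1E; have [_ ->] := dE t.
Qed.

Lemma gamma_integrand_infty_cvg0 p : gamma_integrand p n.+2%:R @[n --> \oo] --> (0 : R).
Proof.
pose k := Num.bound `|p|.
have pk : p <= k%:R by rewrite (le_trans (ler_norm _))// ltW// archi_boundP.
apply: (@squeeze_cvgr _ _ _ _ (fun=> 0) (fun n => k.+1`!%:R * (harmonic n : R))).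
- apply: nearW => n; rewrite gamma_integrand_ge0/= /gamma_integrand expRN.
  have t0 : 0 < n.+2%:R :> R by [].
  have := expR_ge1Dxn k (ltW t0); set t := n.+2%:R in t0 * => ht.
  have tp : t `^ p <= t ^+ k.
    by rewrite -powR_mulrn ?(ltW t0)// ler_powR// ler1n.
  have f0 : 0 < k.+1`!%:R :> R by rewrite ltr0n fact_gt0.
  have e0 := expR_gt0 t.
  have h2 : t ^+ k.+1 <= k.+1`!%:R * expR t.
    rewrite mulrC -ler_pdivrMr//; apply: le_trans ht; lra.
  rewrite /harmonic /= ler_pdivrMr// mulrAC ler_pdivlMr ?ltr0Sn//.
  apply: le_trans h2; rewrite exprSr ler_pM ?powR_ge0//.
  by rewrite ler_nat.
- exact: cvg_cst.
- rewrite -(mulr0 (k.+1`!%:R)); apply: cvgM; [exact: cvg_cst|exact: cvg_harmonic].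
Qed.

Lemma cvg_invn0 : n.+2%:R^-1 @[n --> \oo] --> (0 : R).
Proof.
have : [sequence (harmonic (n + 1)%N : R)]_n @ \oo --> (0 : R).
  by rewrite (@cvg_shiftn 1); exact: cvg_harmonic.
by apply: cvg_trans; apply: near_eq_cvg; apply: nearW => n; rewrite /harmonic/= addn1.
Qed.

Lemma cvg_invn_right : n.+2%:R^-1 @[n --> \oo] --> (0 : R)^'+.
Proof.
move=> A hA; have h : \forall n \near \oo, 0 < n.+2%:R^-1 :> R -> A n.+2%:R^-1.
  exact: (cvg_invn0 hA).
by move: h; apply: filterS => n /=; apply; rewrite invr_gt0.
Qed.

Lemma cvg_expRN_invn : expR (- n.+2%:R^-1) @[n --> \oo] --> (1 : R).
Proof.
have := cvg_comp _ _ cvg_invn0 (@continuous_expRN 0).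
by rewrite oppr0 expR0.
Qed.

Lemma gamma_integrand_zero_cvg0 p : 0 < p -> gamma_integrand p n.+2%:R^-1 @[n --> \oo] --> (0 : R).
Proof.
move=> p0; rewrite -(mul0r (1 : R)); apply: cvgM; last exact: cvg_expRN_invn.
exact: (cvg_comp _ _ cvg_invn_right (powR_cvg0 p0)).
Qed.

Lemma gamma_integrand0_zero_cvg1 : gamma_integrand 0 n.+2%:R^-1 @[n --> \oo] --> (1 : R).
Proof.
under eq_fun do rewrite /gamma_integrand powRr0 mul1r.
exact: cvg_expRN_invn.
Qed.

(** The limit of the previous identity, in extended reals, so that no
    integrability has to be known beforehand. *)
Lemma gamma_integral_rec p (L : R) :
  gamma_integrand p n.+2%:R^-1 @[n --> \oo] --> L ->
  gamma_integral p = (L%:E + p%:E * gamma_integral (p - 1))%E.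
Proof.
move=> hL; have := @integral_exhaustion_cvg p; move/cvg_unique; apply => //.
have -> : (fun n => \int[mu]_(t in exhaustion n) (gamma_integrand p t)%:E)%E =
  (fun n => (gamma_integrand p n.+2%:R^-1 - gamma_integrand p n.+2%:R)%:E +
     p%:E * \int[mu]_(t in exhaustion n) (gamma_integrand (p - 1) t)%:E)%E.
  apply/funext => n.
  have fE q : (\int[mu]_(t in exhaustion n) (gamma_integrand q t)%:E)%E =
      (\int[mu]_(t in exhaustion n) gamma_integrand q t)%:E.
    rewrite fineK//; apply: integrable_fin_num; [exact: measurable_itv|].
    exact: integrable_exhaustion.
  by rewrite !fE -EFinM -EFinD Rintegral_exhaustion_parts.
apply: cvgeD => //.
- apply: cvg_EFin; first exact: nearW.
  rewrite -[L]subr0; apply: cvgB => //; exact: gamma_integrand_infty_cvg0.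
- by apply: cvgeZl => //; exact: integral_exhaustion_cvg.
Qed.

Lemma gamma_integral_ge0 p : (0 <= gamma_integral p)%E.
Proof. by apply: integral_ge0 => t _; rewrite lee_fin gamma_integrand_ge0. Qed.

Lemma gamma_integralS p : -1 < p -> gamma_integral (p + 1) = ((p + 1)%:E * gamma_integral p)%E.
Proof.
move=> p1; rewrite (@gamma_integral_rec _ 0) ?addrK ?add0e//.
by apply: gamma_integrand_zero_cvg0; lra.
Qed.

Lemma gamma_integral_nat n : (gamma_integral n%:R < +oo)%E.
Proof.
elim: n => [|n IHn].
  by rewrite (@gamma_integral_rec _ 1 gamma_integrand0_zero_cvg1) mul0e adde0 ltry.
rewrite -natr1 gamma_integralS; last by rewrite (lt_le_trans _ (ler0n _ n)).
by rewrite lte_mul_pinfty// lee_fin addr_ge0.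
Qed.

(** For [p >= 0] the integrand is dominated by those of exponents [0] and a
    large integer; the recurrence carries finiteness down to [p > -1]. *)
Lemma gamma_integral_ltpinfty p : -1 < p -> (gamma_integral p < +oo)%E.
Proof.
have nneg q : 0 <= q -> (gamma_integral q < +oo)%E.
  move=> q0; pose k := Num.bound q.
  have qk : q <= k%:R by rewrite ltW// archi_boundP.
  apply: (@le_lt_trans _ _ (gamma_integral 0 + gamma_integral k%:R)%E); last first.
    by rewrite lte_add_pinfty ?(gamma_integral_nat 0) ?gamma_integral_nat.
  rewrite /gamma_integral -ge0_integralD//; last 4 first.
  - by move=> t _; rewrite lee_fin gamma_integrand_ge0.
  - by apply/measurable_EFinP; exact: measurable_gamma_integrand.
  - by move=> t _; rewrite lee_fin gamma_integrand_ge0.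
  - by apply/measurable_EFinP; exact: measurable_gamma_integrand.
  apply: ge0_le_integral => //.
  - by move=> t _; rewrite lee_fin gamma_integrand_ge0.
  - by apply/measurable_EFinP; exact: measurable_gamma_integrand.
  - apply/measurable_EFinP; apply: measurable_funD; exact: measurable_gamma_integrand.
  - move=> t /=; rewrite in_itv/= andbT => t0; rewrite -EFinD lee_fin /gamma_integrand -mulrDl.
    rewrite ler_wpM2r ?expR_ge0// powRr0.
    have [t1|t1] := leP t 1.
      have := @ger_powR R t (introT andP (conj t0 t1)) 0 q q0.
      by rewrite powRr0 => /le_trans; apply; rewrite lerDl powR_ge0.
    have := @ler_powR R t (ltW t1) q k%:R qk.
    by move=> /le_trans; apply; rewrite lerDr.
move=> p1; have : (gamma_integral (p + 1) < +oo)%E by apply: nneg; lra.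
rewrite gamma_integralS//; case: (gamma_integral p) => [r||]; rewrite ?ltry ?ltNyr//.
by rewrite gt0_muley// lte_fin; lra.
Qed.

Lemma gamma_integral_gt0 p : -1 < p -> (0 < gamma_integral p)%E.
Proof.
move=> p1.
apply: (@lt_le_trans _ _ (\int[mu]_(t in `[1%R, 2%R]) (2^-1 * expR (-2))%:E)%E).
  rewrite integral_cst//= lebesgue_measure_itv/= lte_fin ltr1n -EFinD -EFinM lte_fin.
  by rewrite !mulr_gt0 ?expR_gt0 ?invr_gt0// subr_gt0 ltr1n.
apply: (@le_trans _ _ (\int[mu]_(t in `[1%R, 2%R]) (gamma_integrand p t)%:E)%E).
  apply: ge0_le_integral => //.
  - by apply/measurable_EFinP; exact: measurable_gamma_integrand.
  - move=> t /=; rewrite in_itv/= => /andP[t1 t2]; rewrite lee_fin /gamma_integrand.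
    rewrite ler_pM ?expR_ge0//; last by rewrite ler_expR lerN2.
    rewrite (@le_trans _ _ (t `^ -1))//; last by rewrite ler_powR// ltW.
    by rewrite powR_inv1 ?lef_pV2 ?posrE//; lra.
apply: ge0_subset_integral => //.
- by apply/measurable_EFinP; exact: measurable_gamma_integrand.
- by move=> t _; rewrite lee_fin gamma_integrand_ge0.
- by move=> t /=; rewrite !in_itv/= andbT => /andP[t1 _]; lra.
Qed.

End GammaIntegral.

Lemma Gamma_gt0 (R : realType) (x : R) : 0 < x -> 0 < Gamma x.
Proof.
move=> x0; apply: fine_gt0; apply/andP; split.
  by apply: (@gamma_integral_gt0 R (x - 1)); lra.
by apply: (@gamma_integral_ltpinfty R (x - 1)); lra.
Qed.

Lemma GammaS (R : realType) (x : R) : 0 < x -> Gamma (x + 1) = x * Gamma x.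
Proof.
move=> x0; have x1 : -1 < x - 1 by lra.
rewrite /Gamma /Rintegral.
rewrite -[X in fine X]/(gamma_integral (x + 1 - 1)) -[X in _ * fine X]/(@gamma_integral R (x - 1)).
rewrite addrK -{1}[x](subrK 1) gamma_integralS// subrK fineM//.
rewrite fin_numElt gamma_integral_ltpinfty// andbT.
by rewrite (lt_le_trans _ (gamma_integral_ge0 (x - 1))).
Qed.

(** * Power series and difference quotients *)

(** Facts on sequences and neighbourhoods of an arbitrary numeric field, stated
    over an abstract field so that they can be used on complex numbers without
    unfolding these. *)
Section NumFieldSequences.
Variable K : numFieldType.
Implicit Types P Q : set K^o.

Lemma nbhsS (z0 : K^o) P Q : P `<=` Q -> nbhs z0 P -> nbhs z0 Q.
Proof. by move=> PQ; apply: filterS. Qed.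

Lemma nbhsI (z0 : K^o) P Q : nbhs z0 P -> nbhs z0 Q -> nbhs z0 (P `&` Q).
Proof. exact: filterI. Qed.

Lemma nbhs_all (z0 : K^o) P : (forall z, P z) -> nbhs z0 P.
Proof. by move=> h; apply: filterE. Qed.

Lemma nbhs_self (z0 : K^o) P : nbhs z0 P -> P z0.
Proof. exact: nbhs_singleton. Qed.

Lemma nbhs_norm_lt (z0 : K^o) (e : K) :
  0 < e -> nbhs z0 (fun z : K^o => `|z - z0| < e).
Proof.
move=> e0; apply/nbhs_ballP; exists e => //= z.
by rewrite /ball/= distrC.
Qed.

Lemma cvgn_eventually (x : nat -> K^o) (l : K^o) k :
  (forall n, (k <= n)%N -> x n = l) -> x n @[n --> \oo] --> l.
Proof.
move=> h; apply: cvg_near_cst; near=> n; apply: h.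
by near: n; exact: nbhs_infty_ge.
Unshelve. all: by end_near. Qed.

Lemma cvgn_add (x y : nat -> K^o) (a b : K^o) :
  x n @[n --> \oo] --> a -> y n @[n --> \oo] --> b ->
  x n + y n @[n --> \oo] --> a + b.
Proof. by move=> hx hy; apply: cvgD. Qed.

Lemma cvgn_sub (x y : nat -> K^o) (a b : K^o) :
  x n @[n --> \oo] --> a -> y n @[n --> \oo] --> b ->
  x n - y n @[n --> \oo] --> a - b.
Proof. by move=> hx hy; apply: cvgB. Qed.

Lemma cvgn_cst (a : K^o) : a @[n --> \oo] --> a.
Proof. exact: cvg_cst. Qed.

Lemma cvgn_unique (x : nat -> K^o) (a b : K^o) :
  x n @[n --> \oo] --> a -> x n @[n --> \oo] --> b -> a = b.
Proof. by move=> hx hy; apply: cvg_unique hx hy. Qed.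

Lemma cvgn_mull (x : nat -> K^o) (c a : K^o) :
  x n @[n --> \oo] --> a -> c * x n @[n --> \oo] --> c * a.
Proof. by move=> hx; apply: cvgM => //; exact: cvgn_cst. Qed.

Lemma cvgn_unshift (x : nat -> K^o) (a : K^o) :
  x n.+1 @[n --> \oo] --> a -> x n @[n --> \oo] --> a.
Proof. by rewrite cvg_shiftS. Qed.

Lemma cvgn_shift (x : nat -> K^o) (a : K^o) :
  x n @[n --> \oo] --> a -> x n.+1 @[n --> \oo] --> a.
Proof. by move=> hx; rewrite cvg_shiftS. Qed.

(** A contracting affine recursion driven by a null sequence tends to zero. *)
Lemma cvg0_contraction (q : K^o) (x t : nat -> K^o) :
  (2^-1 : K^o) ^+ n @[n --> \oo] --> (0 : K^o) ->
  `|q| <= 2^-1 -> x n @[n --> \oo] --> (0 : K^o) ->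
  (forall n, t n.+1 = x n + q * t n) -> t n @[n --> \oo] --> (0 : K^o).
Proof.
move=> h2n q2 x0 tS; apply/cvgr0Pnorm_lt => e e0.
have e4 : 0 < e / 4 by rewrite divr_gt0.
have [n0 _ hx] := (cvgr0Pnorm_lt _).1 x0 _ e4.
have hk k : `|t (n0 + k)%N| <= e / 2 + `|t n0| * 2^-1 ^+ k.
  elim: k => [|k IHk]; first by rewrite addn0 expr0 mulr1 lerDr divr_ge0// ltW.
  rewrite addnS tS (le_trans (ler_normD _ _))//.
  have h1 : `|x (n0 + k)%N| <= e / 4 by apply/ltW/hx; rewrite /= leq_addr.
  have h2 : `|q * t (n0 + k)%N| <= 2^-1 * (e / 2 + `|t n0| * 2^-1 ^+ k).
    by rewrite normrM ler_pM.
  apply: le_trans (lerD h1 h2) _; rewrite exprS le_eqVlt; apply/orP; left; apply/eqP.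
  by field.
have : `|t n0| * (2^-1 : K^o) ^+ k @[k --> \oo] --> (0 : K^o).
  by have := @cvgn_mull _ (`|t n0| : K^o) _ h2n; rewrite mulr0.
have e2 : 0 < e / 2 by rewrite divr_gt0.
move=> /cvgr0Pnorm_lt /(_ _ e2) [k0 _ hk0].
exists (n0 + k0)%N => //= n /= hn.
have hn' : (n = n0 + (n - n0))%N by lia.
rewrite hn' (le_lt_trans (hk _))//.
have /hk0 : (k0 <= n - n0)%N by lia.
rewrite /= ger0_norm; last by rewrite mulr_ge0// exprn_ge0// invr_ge0.
by move=> h; rewrite [ltRHS](splitr e) ltrD2l.
Qed.

End NumFieldSequences.

Section Analytic.
Variable R : realType.
Notation C := (R[i]^o).
Implicit Types (D : set C) (f g : C -> C) (z a : C).

Lemma analytic_in_cst D a : analytic_in D (fun=> a).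
Proof.
move=> z0 _; exists (fun k => if k == 0%N then a else 0); apply: nbhs_all => z.
apply: (@cvgn_eventually _ _ _ 1%N) => n n0.
rewrite big_ltn// expr0 mulr1 big_nat_cond big1 ?addr0// => k /andP[/andP[k0 _] _].
by rewrite gtn_eqF// mul0r.
Qed.

Lemma analytic_inD D f g : analytic_in D f -> analytic_in D g ->
  analytic_in D (fun z => f z + g z).
Proof.
move=> hf hg z0 Dz0; have [a ha] := hf _ Dz0; have [b hb] := hg _ Dz0.
exists (fun k => a k + b k); apply: nbhsS (nbhsI ha hb) => z [h1 h2].
have -> : (fun n => \sum_(0 <= k < n) (a k + b k) * (z - z0) ^+ k) =
  (fun n => \sum_(0 <= k < n) a k * (z - z0) ^+ k +
            \sum_(0 <= k < n) b k * (z - z0) ^+ k).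
  by apply/funext => n; rewrite -big_split/=; apply: eq_bigr => k _; rewrite mulrDl.
exact: (cvgn_add h1 h2).
Qed.

Lemma analytic_inZ D a f : analytic_in D f -> analytic_in D (fun z => a * f z).
Proof.
move=> hf z0 Dz0; have [c hc] := hf _ Dz0.
exists (fun k => a * c k); apply: nbhsS hc => z h1.
have -> : (fun n => \sum_(0 <= k < n) (a * c k) * (z - z0) ^+ k) =
  (fun n => a * \sum_(0 <= k < n) c k * (z - z0) ^+ k).
  by apply/funext => n; rewrite big_distrr/=; apply: eq_bigr => k _; rewrite mulrA.
exact: (cvgn_mull h1).
Qed.

Lemma analytic_in_sum D (I : Type) (r : seq I) (P : pred I) (F : I -> C -> C) :
  (forall i, P i -> analytic_in D (F i)) ->
  analytic_in D (fun z => \sum_(i <- r | P i) F i z).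
Proof.
move=> hF; elim: r => [|i r IHr].
  have -> : (fun z => \sum_(i <- [::] | P i) F i z) = (fun=> 0).
    by apply/funext => z; rewrite big_nil.
  exact: analytic_in_cst.
have [Pi|Pi] := boolP (P i).
  have -> : (fun z => \sum_(i <- i :: r | P i) F i z) =
      (fun z => F i z + \sum_(i <- r | P i) F i z).
    by apply/funext => z; rewrite big_cons Pi.
  exact: (analytic_inD (hF i Pi) IHr).
have -> : (fun z => \sum_(i <- i :: r | P i) F i z) =
    (fun z => \sum_(i <- r | P i) F i z).
  by apply/funext => z; rewrite big_cons (negbTE Pi).
exact: IHr.
Qed.

Lemma cvg_half_expr : (2^-1 : C) ^+ n @[n --> \oo] --> (0 : C).
Proof.
apply/cvgr0Pnorm_lt => e e0.
have : (2^-1 : R) ^+ n @[n --> \oo] --> (0 : R).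
  by apply: cvg_expr; rewrite ger0_norm ?invf_lt1 ?ltr1n.
have [r re] : exists r : R, e = r%:C.
  by exists (complex.Re e); rewrite RRe_real// gtr0_real.
have r0 : 0 < r by move: e0; rewrite re ltcR.
move=> /cvgr0Pnorm_lt/(_ _ r0) [k _ hk]; exists k => //= n /hk /=.
rewrite re; have -> : (2^-1 : C) ^+ n = ((2^-1) ^+ n)%:C.
  by rewrite rmorphXn/= fmorphV rmorph_nat.
by rewrite ger0_norm ?ger0_norm ?exprn_ge0 ?invr_ge0 ?ltcR// lecR exprn_ge0.
Qed.

(** The difference quotient of an analytic function at [a] extends
    analytically over [a]. Around [a], one shifts the coefficients. Around
    [z0 != a], the series [c'] of [f - f a] is divided by
    [(z - z0) + (z0 - a)]: the coefficients of the quotient solve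
    [b_k = (c'_k - b_(k-1)) / (z0 - a)]. *)
Lemma analytic_in_slope D f a : D a -> analytic_in D f ->
  exists F : C -> C, analytic_in D F /\
    (forall z, z != a -> F z = (f z - f a) / (z - a)).
Proof.
move=> Da hf; have [c hc] := hf _ Da.
have fa : f a = c 0%N.
  have := nbhs_self hc; rewrite subrr => h.
  apply: (cvgn_unique h).
  apply: (@cvgn_eventually _ _ _ 1%N) => n n0.
  rewrite big_ltn// expr0 mulr1 big_nat_cond big1 ?addr0// => k /andP[/andP[k0 _] _].
  by rewrite expr0n gtn_eqF// mulr0.
exists (fun z => if z == a then c 1%N else (f z - f a) / (z - a)); split; last first.
  by move=> z za; rewrite (negbTE za).
move=> z0 Dz0; have [->|z0a] := eqVneq z0 a.
  exists (fun k => c k.+1); apply: nbhsS hc => z hz.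
  have [->|za] := eqVneq z a.
    apply: (@cvgn_eventually _ _ _ 1%N) => n n0.
    rewrite big_ltn// subrr expr0 mulr1 big_nat_cond big1 ?addr0//.
    by move=> k /andP[/andP[k0 _] _]; rewrite expr0n gtn_eqF// mulr0.
  have za0 : z - a != 0 by rewrite subr_eq0.
  have -> : (fun n => \sum_(0 <= k < n) c k.+1 * (z - a) ^+ k) =
      (fun n => (z - a)^-1 * (\sum_(0 <= k < n.+1) c k * (z - a) ^+ k - f a)).
    apply/funext => n; rewrite big_nat_recl// expr0 mulr1 fa [_ + _ - _]addrAC.
    rewrite subrr add0r big_distrr/=; apply: eq_bigr => k _.
    by rewrite exprS [c _ * (_ * _)]mulrCA mulKf.
  rewrite mulrC; apply: cvgn_mull; apply: cvgn_sub; last exact: cvgn_cst.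
  exact: (cvgn_shift hz).
have [c0 hc0] := hf _ Dz0.
pose d := z0 - a; have d0 : d != 0 by rewrite subr_eq0.
pose c' k := if k == 0%N then c0 0%N - f a else c0 k.
pose b := fix b k := match k with
  | 0 => c' 0%N / d | k'.+1 => (c' k'.+1 - b k') / d end.
have d2 : 0 < `|d| / 2 by rewrite divr_gt0// normr_gt0.
exists b; apply: nbhsS (nbhsI hc0 (nbhs_norm_lt z0 d2)) => z [hz dz].
set u := z - z0 in hz dz *.
have ud : z - a = u + d by rewrite /u /d addrA subrK.
have ud0 : u + d != 0.
  apply/eqP => h; move: dz; have -> : u = - d by apply/eqP; rewrite -addr_eq0 h.
  by rewrite normrN ltr_pdivlMr// gtr_pMr ?normr_gt0// ltrn1.
have za : z != a by rewrite -subr_eq0 ud.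
rewrite (negbTE za) ud.
pose S n := \sum_(0 <= k < n) c0 k * u ^+ k.
have hB n : (u + d) * \sum_(0 <= k < n.+1) b k * u ^+ k =
    S n.+1 - f a + u * (b n * u ^+ n).
  elim: n => [|n IHn].
    by rewrite /S !big_nat1 !expr0 !mulr1 /= /c' /= mulrDl addrC [d * _]mulrC divfK.
  rewrite big_nat_recr//= mulrDr IHn /S [in RHS]big_nat_recr//= -/S /c' /= exprS.
  by field.
(* the remainder left by a truncated division tends to zero *)
have ht : b n * u ^+ n @[n --> \oo] --> (0 : C).
  apply: (@cvg0_contraction _ (- (u / d)) (fun n => d^-1 * (S n.+2 - S n.+1))).
  - exact: cvg_half_expr.
  - by rewrite normrN normf_div ler_pdivrMr ?normr_gt0// mulrC ltW.
  - have := @cvgn_mull _ _ d^-1 _ (cvgn_sub (cvgn_shift (cvgn_shift hz)) (cvgn_shift hz)).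
    by rewrite subrr mulr0.
  - move=> n; rewrite /S [X in X - _]big_nat_recr//= addrAC subrr add0r /c' /= exprS.
    by field.
apply: cvgn_unshift.
have -> : (fun n => \sum_(0 <= k < n.+1) b k * u ^+ k) =
    (fun n => (u + d)^-1 * ((S n.+1 - f a) + u * (b n * u ^+ n))).
  by apply/funext => n; rewrite -hB mulKf.
rewrite [_ / _]mulrC; apply: cvgn_mull; rewrite -[f z - f a]addr0; apply: cvgn_add.
  apply: cvgn_sub; [exact: (cvgn_shift hz)|exact: cvg_cst].
by have := @cvgn_mull _ _ u _ ht; rewrite mulr0.
Qed.
End Analytic.

(** * Partial fractions and products over pairs of indices *)

Section PartialFractions.
Variables (F : fieldType) (I : eqType) (u v : I -> F).
Implicit Types (r : seq I) (z : F).

(** The expansion of a product of factors [(z - u_i) / (z - v_i)] with distinct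
    [v_i], by adding one factor at a time; the coefficient at the new pole is
    the old product evaluated there. *)
Lemma partial_fractions r z : uniq r -> {in r &, injective v} ->
  (forall i, i \in r -> z != v i) ->
  \prod_(i <- r) ((z - u i) / (z - v i)) =
  1 + \sum_(i <- r)
    (v i - u i) * (\prod_(j <- r | j != i) ((v i - u j) / (v i - v j)))
    / (z - v i).
Proof.
elim: r z => [|x r IHr] z /=; first by rewrite !big_nil addr0.
move=> /andP[xr ur] vi zv.
have vi' : {in r &, injective v}.
  by move=> i j ir jr; apply: vi; rewrite inE (ir, jr) orbT.
have vx i : i \in r -> v x != v i.
  move=> ir; apply: contraNneq xr => h.
  by rewrite (vi x i) ?inE ?eqxx ?ir ?orbT.
have zx : z - v x != 0 by rewrite subr_eq0 zv// inE eqxx.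
have zr i : i \in r -> z != v i by move=> ir; rewrite zv// inE ir orbT.
rewrite !big_cons eqxx/= IHr//.
have -> : \prod_(j <- r | j != x) ((v x - u j) / (v x - v j)) =
    \prod_(j <- r) ((v x - u j) / (v x - v j)).
  rewrite big_seq_cond [RHS]big_seq; apply: eq_bigl => j.
  by case jr: (j \in r); rewrite //= (memPn xr).
pose c i := (v i - u i) * \prod_(j <- r | j != i) ((v i - u j) / (v i - v j)).
rewrite (IHr (v x))//.
have -> : \sum_(i <- r) (v i - u i) *
      (\prod_(j <- x :: r | j != i) ((v i - u j) / (v i - v j))) / (z - v i) =
    \sum_(i <- r) c i * ((v i - u x) / (v i - v x)) / (z - v i).
  apply: eq_big_seq => i ir; rewrite big_cons.
  have -> /= : x != i by apply: contraNneq xr => ->.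
  by rewrite /c [_ / (v i - v x) * _]mulrC !mulrA.
have -> : (z - u x) / (z - v x) = 1 + (v x - u x) / (z - v x) by field.
set S1 := \sum_(i <- r) _ / (z - v i).
set S2 := \sum_(i <- r) _ / (v x - v i).
set S3 := \sum_(i <- r) _ / (z - v i).
suff key : S1 + (v x - u x) / (z - v x) * S1 = (v x - u x) / (z - v x) * S2 + S3.
  have -> : (v x - u x) * (1 + S2) / (z - v x) =
    (v x - u x) / (z - v x) + (v x - u x) / (z - v x) * S2 by field.
  by rewrite -addrA -key; ring.
rewrite /S1 /S2 /S3.
rewrite !big_distrr/= -!big_split/=; apply: eq_big_seq => i ir.
rewrite /c; set P := \prod_(j <- r | j != i) _.
have zi : z - v i != 0 by rewrite subr_eq0 zr.
have xi : v x - v i != 0 by rewrite subr_eq0 vx.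
have ix : v i - v x != 0 by rewrite subr_eq0 eq_sym vx.
by field; rewrite zi xi ix zx.
Qed.

(** The same expansion when poles may coincide, provided that the factors with
    a blocked index multiply to [1], that the poles of unblocked index are
    simple, and that the formal coefficient of each blocked index vanishes. *)
Lemma partial_fractions_blocked (b : pred I) r z : uniq r ->
  (forall i j, i \in r -> j \in r -> ~~ b i -> i != j -> v i != v j) ->
  (forall y, (forall i, i \in r -> b i -> y != v i) ->
    \prod_(i <- r | b i) ((y - u i) / (y - v i)) = 1) ->
  (forall i, i \in r -> b i -> exists2 j, j \in r & (j != i) && (v i == u j)) ->
  (forall i, i \in r -> z != v i) ->
  \prod_(i <- r) ((z - u i) / (z - v i)) =
  1 + \sum_(i <- r)
    (v i - u i) * (\prod_(j <- r | j != i) ((v i - u j) / (v i - v j)))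
    / (z - v i).
Proof.
move=> ur vi b1 b0 zv.
rewrite (bigID b)/= b1 ?mul1r; last by move=> i ir _; exact: zv.
rewrite -big_filter partial_fractions ?filter_uniq//; last 2 first.
- move=> i j; rewrite !mem_filter => /andP[bi ir] /andP[bj jr] /eqP.
  by apply: contraTeq => ij; exact: vi.
- by move=> i; rewrite mem_filter => /andP[_]; exact: zv.
congr (1 + _); rewrite big_filter [RHS](bigID b)/= [X in _ = X + _]big1_seq ?add0r; last first.
  move=> i /andP[bi ir]; have [j jr /andP[ji /eqP vu]] := b0 i ir bi.
  have -> : \prod_(j <- r | j != i) ((v i - u j) / (v i - v j)) = 0.
    by apply/eqP; rewrite prodf_seq_eq0; apply/hasP; exists j; rewrite //= ji vu subrr mul0r eqxx.
  by rewrite mulr0 mul0r.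
rewrite big_seq_cond [RHS]big_seq_cond; apply: eq_bigr => i /andP[ir bi].
congr (_ * _ / _); rewrite big_filter_cond [RHS](bigID b)/=.
have -> : \prod_(j <- r | (j != i) && b j) ((v i - u j) / (v i - v j)) = 1.
  rewrite -[RHS](b1 (v i)); last first.
    by move=> j jr bj; apply: vi => //; apply: contraNneq bi => ->.
  by apply: eq_bigl => j; case: eqP => // ->; rewrite (negbTE bi).
by rewrite mul1r; apply: eq_bigl => j; rewrite andbC.
Qed.
End PartialFractions.

Section PairProducts.
Variable F : fieldType.
Implicit Types (G H : nat -> nat -> F) (rel : rel nat).

Lemma prod_row rel G n n' i : (1 <= i < n)%N ->
  (forall p q, p != i -> G p q = 1) ->
  \prod_(1 <= p < n) \prod_(1 <= q < n' | rel p q) G p q =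
  \prod_(1 <= q < n' | rel i q) G i q.
Proof.
move=> hi hG; rewrite (bigD1_seq i) ?mem_index_iota ?iota_uniq//=.
rewrite [X in _ * X]big1 ?mulr1// => p pi.
by rewrite big1// => q _; exact: hG.
Qed.

Lemma prod_col rel G n n' i : (1 <= i < n')%N ->
  (forall p q, q != i -> G p q = 1) ->
  \prod_(1 <= p < n) \prod_(1 <= q < n' | rel p q) G p q =
  \prod_(1 <= p < n | rel p i) G p i.
Proof.
move=> hi hG; rewrite [RHS]big_mkcond; apply: eq_bigr => p _.
rewrite big_mkcond (bigD1_seq i) ?mem_index_iota ?iota_uniq//=.
rewrite [X in _ * X]big1 ?mulr1// => q qi.
by rewrite hG// if_same.
Qed.

(** The pairs [p < q] that contain a given index [i] are parametrized by the
    other member. *)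
Lemma prod_cross G (X : nat -> F) n i : (1 <= i < n)%N ->
  (forall p q, p != i -> q != i -> G p q = 1) ->
  (forall q, q != i -> G i q = X q) -> (forall p, p != i -> G p i = X p) ->
  \prod_(1 <= p < n) \prod_(1 <= q < n | (p < q)%N) G p q =
  \prod_(1 <= j < n | j != i) X j.
Proof.
move=> hi hG hr hc; rewrite (bigD1_seq i) ?mem_index_iota ?iota_uniq//=.
have -> : \prod_(1 <= q < n | (i < q)%N) G i q =
    \prod_(1 <= j < n | (j != i) && (i < j)%N) X j.
  apply: eq_big => [q|q iq]; first by case: ltngtP.
  by rewrite hr// gtn_eqF.
rewrite [RHS](bigID (fun j => (i < j)%N))/=; congr (_ * _).
rewrite [LHS]big_mkcond [RHS]big_mkcond; apply: eq_bigr => p _.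
have [->//|pi] := eqVneq p i.
rewrite big_mkcond (bigD1_seq i) ?mem_index_iota ?iota_uniq//=.
rewrite [X in _ * X]big1 ?mulr1; last first.
  by move=> q qi; rewrite hG// if_same.
have -> : (i < p)%N = ~~ (p < i)%N by move: pi; lia.
by rewrite negbK hc.
Qed.

Lemma prod_pairM rel G H K n n' :
  (forall p q, (1 <= p < n)%N -> (1 <= q < n')%N -> rel p q ->
    G p q = H p q * K p q) ->
  \prod_(1 <= p < n) \prod_(1 <= q < n' | rel p q) G p q =
  \prod_(1 <= p < n) \prod_(1 <= q < n' | rel p q) H p q *
  \prod_(1 <= p < n) \prod_(1 <= q < n' | rel p q) K p q.
Proof.
move=> h; rewrite -big_split/=; apply: eq_big_nat => p hp.
rewrite -big_split/=; rewrite big_nat_cond [RHS]big_nat_cond.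
by apply: eq_bigr => q /andP[hq rpq]; apply: h.
Qed.

End PairProducts.

(** * Weights and residues under a unit shift of one coordinate *)

(* Nonvanishing side conditions whose sign follows by linear arithmetic. *)
Ltac neq0_lra :=
  repeat (apply/andP; split);
  first [by apply: lt0r_neq0; lra | by apply: ltr0_neq0; lra].

Section Weights.
Variables (R : realFieldType) (theta : R) (g : R -> R).
Hypothesis theta_gt0 : 0 < theta.
Hypothesis theta_neq1 : theta != 1.
Hypothesis gS : forall x, 0 < x -> 0 < x - theta + 1 ->
  g (x + 1) = g x * (x / (x - theta + 1)).
Implicit Types (l m : nat -> R).

(** The inequalities satisfied by the coordinates of an interlacing
    configuration; indices run from [1] to [N] for [l] and to [N - 1] for [m]. *)
Definition admissible N l m : Prop :=
  [/\ forall i j, (1 <= i)%N -> (i < j)%N -> (j <= N)%N -> l j + theta <= l i,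
      forall i j, (1 <= i)%N -> (i < j)%N -> (j < N)%N -> m j + theta <= m i,
      forall i j, (1 <= i)%N -> (i < j)%N -> (j <= N)%N -> l j + theta <= m i &
      forall i j, (1 <= i)%N -> (i <= j)%N -> (j < N)%N -> m j <= l i].

(** The weight without the factors [w] and [tau], for functions [l] and [m] of
    a 1-based index. In the third product [m] is formally evaluated at [N], but
    no [q] satisfies [N < q < N.+1]. *)
Definition red_weight N l m : R :=
  (\prod_(1 <= p < N.+1) \prod_(1 <= q < N.+1 | (p < q)%N) (l p - l q))
  * (\prod_(1 <= p < N) \prod_(1 <= q < N | (p < q)%N) (m p - m q))
  * (\prod_(1 <= p < N.+1) \prod_(1 <= q < N.+1 | (p < q)%N) g (m p - l q))
  * (\prod_(1 <= p < N) \prod_(1 <= q < N | (p <= q)%N) g (l p - m q + theta)).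

(** The residues of the three products: [resA] at [l_i] for the first, [resC] at
    [m_i + 1] for the second, [resB] at [l_i + 1] and [resD] at [m_i] for the
    third. *)
Definition resA N l i : R :=
  - theta * \prod_(1 <= j < N.+1 | j != i) ((l i - l j - theta) / (l i - l j)).
Definition resB N l m i : R :=
  (1 - theta)
  * (\prod_(1 <= j < N.+1 | j != i) ((l i + 1 - l j - theta) / (l i - l j)))
  * \prod_(1 <= j < N) ((l i - m j + theta) / (l i + 1 - m j)).
Definition resC N m i : R :=
  theta * \prod_(1 <= j < N | j != i) ((m i - m j + theta) / (m i - m j)).
Definition resD N l m i : R :=
  (theta - 1)
  * (\prod_(1 <= j < N.+1) ((m i - l j - theta) / (m i - l j - 1)))
  * \prod_(1 <= j < N | j != i) ((m i - m j + theta - 1) / (m i - m j)).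

(** Raising [x i] by one changes only the factors of the pairs containing [i]. *)
Lemma vandermonde_shift n (x y : nat -> R) i : (1 <= i < n)%N ->
  (forall p q, (1 <= p)%N -> (p < q)%N -> (q < n)%N -> x q < x p) ->
  y i = x i + 1 -> (forall j, (0 < j)%N -> j != i -> y j = x j) ->
  \prod_(1 <= p < n) \prod_(1 <= q < n | (p < q)%N) (y p - y q) =
  (\prod_(1 <= p < n) \prod_(1 <= q < n | (p < q)%N) (x p - x q)) *
  \prod_(1 <= j < n | j != i) ((x i + 1 - x j) / (x i - x j)).
Proof.
have t0 := theta_gt0; move=> hi xlt yi yj.
pose X j := (x i + 1 - x j) / (x i - x j).
pose G p q := if p == i then X q else if q == i then X p else 1.
have GE : \prod_(1 <= p < n) \prod_(1 <= q < n | (p < q)%N) G p q =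
    \prod_(1 <= j < n | j != i) X j.
  apply: (prod_cross hi) => [p q pi qi|q qi|p pi]; rewrite /G ?eqxx//.
    by rewrite (negbTE pi) (negbTE qi).
  by rewrite (negbTE pi).
rewrite -GE -(prod_pairM (G := fun p q => y p - y q))// => p q hp hq pq; have [p0 q0] : (0 < p)%N /\ (0 < q)%N by lia.
have xpq : x p - x q != 0.
  by rewrite subr_eq0 gt_eqF// xlt//; lia.
rewrite /G /X; have [pi|pi] := eqVneq p i.
  have qi : q != i by rewrite -pi gtn_eqF.
  by rewrite pi in xpq *; rewrite yi yj//; field.
have [qi|qi] := eqVneq q i; last by rewrite !yj// mulr1.
rewrite qi in xpq *; rewrite yi yj//.
have ipq : x i - x p != 0 by rewrite -opprB oppr_eq0.
by field.
Qed.

Lemma red_weight_shift_l N l l' m i : (1 <= i <= N)%N ->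
  admissible N l m -> admissible N l' m ->
  l' i = l i + 1 -> (forall j, (0 < j)%N -> j != i -> l' j = l j) ->
  red_weight N l' m = red_weight N l m
    * (\prod_(1 <= j < N.+1 | j != i) ((l i + 1 - l j) / (l i - l j)))
    * \prod_(1 <= k < N) ((l i - m k + theta) / (l i + 1 - m k)).
Proof.
have t0 := theta_gt0; move=> hi [ll mm ml lm] [ll' _ ml' lm'] l'i l'j.
have hl p q : (1 <= p)%N -> (p < q)%N -> (q < N.+1)%N -> l q < l p.
  by move=> p1 pq qN; have := ll p q p1 pq qN; lra.
have hi' : (1 <= i < N.+1)%N by lia.
rewrite /red_weight (vandermonde_shift hi' hl l'i l'j).
pose Y k := (l i - m k + theta) / (l i + 1 - m k).
pose G3 p q := if q == i then Y p else 1.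
have -> : \prod_(1 <= p < N.+1) \prod_(1 <= q < N.+1 | (p < q)%N) g (m p - l' q) =
    (\prod_(1 <= p < N.+1) \prod_(1 <= q < N.+1 | (p < q)%N) g (m p - l q)) *
    (\prod_(1 <= p < N.+1) \prod_(1 <= q < N.+1 | (p < q)%N) G3 p q).
  apply: prod_pairM => p q hp hq pq; have [p0 q0] : (0 < p)%N /\ (0 < q)%N by lia.
  rewrite /G3.
  have [qi|qi] := eqVneq q i; last by rewrite l'j// mulr1.
  rewrite qi l'i /Y.
  have h1 : l' i + theta <= m p by apply: ml'; lia.
  have x0 : 0 < m p - l i - 1 by rewrite l'i in h1; lra.
  have x1 : 0 < m p - l i - 1 - theta + 1 by rewrite l'i in h1; lra.
  have := gS x0 x1; rewrite subrK => ->.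
  have -> : m p - (l i + 1) = m p - l i - 1 by ring.
  field; neq0_lra.
have -> : \prod_(1 <= p < N.+1) \prod_(1 <= q < N.+1 | (p < q)%N) G3 p q =
    \prod_(1 <= p < N.+1 | (p < i)%N) Y p.
  rewrite (prod_col _ _ hi'); last by move=> p q qi; rewrite /G3 (negbTE qi).
  by apply: eq_bigr => p _; rewrite /G3 eqxx.
pose G4 p q := if p == i then Y q else 1.
have -> : \prod_(1 <= p < N) \prod_(1 <= q < N | (p <= q)%N) g (l' p - m q + theta) =
    (\prod_(1 <= p < N) \prod_(1 <= q < N | (p <= q)%N) g (l p - m q + theta)) *
    (\prod_(1 <= p < N) \prod_(1 <= q < N | (p <= q)%N) G4 p q).
  apply: prod_pairM => p q hp hq pq; have [p0 q0] : (0 < p)%N /\ (0 < q)%N by lia.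
  rewrite /G4.
  have [pi|pi] := eqVneq p i; last by rewrite l'j// mulr1.
  rewrite pi l'i /Y.
  have h1 : m q <= l i by apply: lm; lia.
  have x0 : 0 < l i - m q + theta by lra.
  have x1 : 0 < l i - m q + theta - theta + 1 by lra.
  have -> : l i + 1 - m q + theta = l i - m q + theta + 1 by ring.
  rewrite (gS x0 x1); congr (_ * (_ / _)); ring.
have -> : \prod_(1 <= p < N) \prod_(1 <= q < N | (p <= q)%N) G4 p q =
    \prod_(1 <= q < N | (i <= q)%N) Y q.
  have [iN|iN] := ltnP i N.
    have hiN : (1 <= i < N)%N by lia.
    rewrite (prod_row _ _ hiN); last by move=> p q qi; rewrite /G4 (negbTE qi).
    by apply: eq_bigr => p _; rewrite /G4 eqxx.
  rewrite big_nat big1 => [|p hp].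
    rewrite big_nat_cond big1// => q; lia.
  by rewrite big1// => q _; rewrite /G4 ifN//; lia.
have -> : \prod_(1 <= k < N) Y k =
    (\prod_(1 <= p < N.+1 | (p < i)%N) Y p) * \prod_(1 <= q < N | (i <= q)%N) Y q.
  rewrite (bigID (fun k => (k < i)%N))/=; congr (_ * _); last first.
    by apply: eq_bigl => k; rewrite -leqNgt.
  rewrite [RHS]big_mkcond big_nat_recr/=; last lia.
  by rewrite ifN ?mulr1 -?big_mkcond//; lia.
rewrite -/(Y _); ring.
Qed.

Lemma red_weight_shift_m N l m m' i : (1 <= i < N)%N ->
  admissible N l m -> admissible N l m' ->
  m' i = m i + 1 -> (forall j, (0 < j)%N -> j != i -> m' j = m j) ->
  red_weight N l m' = red_weight N l m
    * (\prod_(1 <= j < N | j != i) ((m i + 1 - m j) / (m i - m j)))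
    * \prod_(1 <= k < N.+1) ((m i - l k) / (m i - l k + 1 - theta)).
Proof.
have t0 := theta_gt0; move=> hi [ll mm ml lm] [_ mm' ml' lm'] m'i m'j.
have hm p q : (1 <= p)%N -> (p < q)%N -> (q < N)%N -> m q < m p.
  by move=> p1 pq qN; have := mm p q p1 pq qN; lra.
rewrite /red_weight (vandermonde_shift hi hm m'i m'j).
pose Y k := (m i - l k) / (m i - l k + 1 - theta).
pose G3 p q := if p == i then Y q else 1.
have -> : \prod_(1 <= p < N.+1) \prod_(1 <= q < N.+1 | (p < q)%N) g (m' p - l q) =
    (\prod_(1 <= p < N.+1) \prod_(1 <= q < N.+1 | (p < q)%N) g (m p - l q)) *
    (\prod_(1 <= p < N.+1) \prod_(1 <= q < N.+1 | (p < q)%N) G3 p q).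
  apply: prod_pairM => p q hp hq pq; have [p0 q0] : (0 < p)%N /\ (0 < q)%N by lia.
  rewrite /G3.
  have [pi|pi] := eqVneq p i; last by rewrite m'j// mulr1.
  rewrite pi m'i /Y.
  have h1 : l q + theta <= m i by apply: ml; lia.
  have x0 : 0 < m i - l q by lra.
  have x1 : 0 < m i - l q - theta + 1 by lra.
  have -> : m i + 1 - l q = m i - l q + 1 by ring.
  rewrite (gS x0 x1); congr (_ * (_ / _)); ring.
have -> : \prod_(1 <= p < N.+1) \prod_(1 <= q < N.+1 | (p < q)%N) G3 p q =
    \prod_(1 <= q < N.+1 | (i < q)%N) Y q.
  have hi' : (1 <= i < N.+1)%N by lia.
  rewrite (prod_row _ _ hi'); last by move=> p q qi; rewrite /G3 (negbTE qi).
  by apply: eq_bigr => p _; rewrite /G3 eqxx.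
pose G4 p q := if q == i then Y p else 1.
have -> : \prod_(1 <= p < N) \prod_(1 <= q < N | (p <= q)%N) g (l p - m' q + theta) =
    (\prod_(1 <= p < N) \prod_(1 <= q < N | (p <= q)%N) g (l p - m q + theta)) *
    (\prod_(1 <= p < N) \prod_(1 <= q < N | (p <= q)%N) G4 p q).
  apply: prod_pairM => p q hp hq pq; have [p0 q0] : (0 < p)%N /\ (0 < q)%N by lia.
  rewrite /G4.
  have [qi|qi] := eqVneq q i; last by rewrite m'j// mulr1.
  rewrite qi m'i /Y.
  have h1 : m' i <= l p by apply: lm'; lia.
  rewrite m'i in h1.
  have x0 : 0 < l p - m i - 1 + theta by lra.
  have x1 : 0 < l p - m i - 1 + theta - theta + 1 by lra.
  have -> : l p - m i + theta = l p - m i - 1 + theta + 1 by ring.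
  rewrite (gS x0 x1).
  have -> : l p - (m i + 1) + theta = l p - m i - 1 + theta by ring.
  by field; neq0_lra.
have -> : \prod_(1 <= p < N) \prod_(1 <= q < N | (p <= q)%N) G4 p q =
    \prod_(1 <= q < N | (q <= i)%N) Y q.
  rewrite (prod_col _ _ hi); last by move=> p q qi; rewrite /G4 (negbTE qi).
  by apply: eq_bigr => p _; rewrite /G4 eqxx.
have -> : \prod_(1 <= k < N.+1) Y k =
    (\prod_(1 <= q < N.+1 | (i < q)%N) Y q) * \prod_(1 <= p < N | (p <= i)%N) Y p.
  rewrite (bigID (fun k => (i < k)%N))/=; congr (_ * _).
  rewrite [LHS]big_mkcond big_nat_recr/=; last lia.
  rewrite [if _ then Y N else _]ifN ?mulr1 -?big_mkcond//; last lia.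
  by apply: eq_bigl => k; rewrite -leqNgt.
rewrite -/(Y _); ring.
Qed.

(** The three pairings: residues, weighted by [red_weight], of two configurations
    that differ by raising [l_i], or [m_i], or both. *)
Lemma resA_resB N l l' m i : (1 <= i <= N)%N ->
  admissible N l m -> admissible N l' m ->
  l' i = l i + 1 -> (forall j, (0 < j)%N -> j != i -> l' j = l j) ->
  resA N l' i * red_weight N l' m = - (theta / (1 - theta) * resB N l m i * red_weight N l m).
Proof.
have t0 := theta_gt0; move=> hi al al' l'i l'j; rewrite (red_weight_shift_l hi al al' l'i l'j).
rewrite /resA /resB.
have -> : \prod_(1 <= j < N.+1 | j != i) ((l i + 1 - l j - theta) / (l i - l j)) =
  (\prod_(1 <= j < N.+1 | j != i) ((l' i - l' j - theta) / (l' i - l' j))) *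
  \prod_(1 <= j < N.+1 | j != i) ((l i + 1 - l j) / (l i - l j)).
  rewrite -big_split/= big_nat_cond [RHS]big_nat_cond.
  apply: eq_bigr => j /andP[hj ji]; have j0 : (0 < j)%N by lia.
  rewrite (l'j j j0 ji) l'i.
  have [ll _ _ _] := al; have [ll' _ _ _] := al'.
  have [ij|ij|ij] := ltngtP i j; last by rewrite ij eqxx in ji.
    have h1 : l j + theta <= l i by apply: ll; lia.
    by field; neq0_lra.
  have h1 : l i + theta <= l j by apply: ll; lia.
  have h2 : l' i + theta <= l' j by apply: ll'; lia.
  rewrite l'i (l'j j j0 ji) in h2.
  by field; neq0_lra.
have t1 : 1 - theta != 0 by rewrite subr_eq0 eq_sym.
by field.
Qed.

Lemma resD_resC N l m m' i : (1 <= i < N)%N ->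
  admissible N l m -> admissible N l m' ->
  m' i = m i + 1 -> (forall j, (0 < j)%N -> j != i -> m' j = m j) ->
  theta / (1 - theta) * resD N l m' i * red_weight N l m' = - (resC N m i * red_weight N l m).
Proof.
have t0 := theta_gt0; move=> hi al al' m'i m'j; rewrite (red_weight_shift_m hi al al' m'i m'j).
have [ll mm ml lm] := al; have [_ mm' ml' lm'] := al'.
rewrite /resD /resC.
have -> : \prod_(1 <= j < N | j != i) ((m i - m j + theta) / (m i - m j)) =
  (\prod_(1 <= j < N | j != i) ((m' i - m' j + theta - 1) / (m' i - m' j))) *
  \prod_(1 <= j < N | j != i) ((m i + 1 - m j) / (m i - m j)).
  rewrite -big_split/= big_nat_cond [RHS]big_nat_cond.
  apply: eq_bigr => j /andP[hj ji]; have j0 : (0 < j)%N by lia.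
  rewrite (m'j j j0 ji) m'i.
  have [ij|ij|ij] := ltngtP i j; last by rewrite ij eqxx in ji.
    have h1 : m j + theta <= m i by apply: mm; lia.
    by field; neq0_lra.
  have h1 : m i + theta <= m j by apply: mm; lia.
  have h2 : m' i + theta <= m' j by apply: mm'; lia.
  rewrite m'i (m'j j j0 ji) in h2.
  by field; neq0_lra.
have P1 : (\prod_(1 <= j < N.+1) ((m' i - l j - theta) / (m' i - l j - 1))) *
   \prod_(1 <= k < N.+1) ((m i - l k) / (m i - l k + 1 - theta)) = 1.
  rewrite -big_split/= big_nat big1// => j hj; rewrite m'i.
  have [ij|ij] := ltnP i j.
    have h1 : l j + theta <= m i by apply: ml; lia.
    by field; neq0_lra.
  have h1 : m' i <= l j by apply: lm'; lia.
  rewrite m'i in h1.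
  by field; neq0_lra.
have t1 : 1 - theta != 0 by rewrite subr_eq0 eq_sym.
move: P1; set A := \prod_(1 <= j < N.+1) _; set B := \prod_(1 <= j < N.+1) _.
set E := \prod_(1 <= j < N | j != i) _; set E' := \prod_(1 <= j < N | j != i) _.
move=> P1; transitivity (A * B * - (theta * (E * E') * red_weight N l m)); first by field.
by rewrite P1 mul1r.
Qed.

Lemma resA_resC N l l' m m' i : (1 <= i < N)%N ->
  admissible N l m -> admissible N l' m -> admissible N l' m' ->
  l i = m i ->
  l' i = l i + 1 -> (forall j, (0 < j)%N -> j != i -> l' j = l j) ->
  m' i = m i + 1 -> (forall j, (0 < j)%N -> j != i -> m' j = m j) ->
  resA N l' i * red_weight N l' m' = - (resC N m i * red_weight N l m).
Proof.
have t0 := theta_gt0; move=> hi al al1 al2 lmi l'i l'j m'i m'j.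
have hi' : (1 <= i <= N)%N by lia.
rewrite (red_weight_shift_m hi al1 al2 m'i m'j) (red_weight_shift_l hi' al al1 l'i l'j).
have [ll mm ml lm] := al; have [ll' _ ml' lm'] := al1; have [_ mm' ml2 lm2] := al2.
rewrite /resA /resC.
have -> : \prod_(1 <= j < N | j != i) ((m i - m j + theta) / (m i - m j)) =
  (\prod_(1 <= k < N | k != i) ((l i - m k + theta) / (l i + 1 - m k))) *
  \prod_(1 <= j < N | j != i) ((m i + 1 - m j) / (m i - m j)).
  rewrite -big_split/= big_nat_cond [RHS]big_nat_cond.
  apply: eq_bigr => j /andP[hj ji]; have j0 : (0 < j)%N by lia.
  rewrite lmi.
  have [ij|ij|ij] := ltngtP i j; last by rewrite ij eqxx in ji.
    have h1 : m j + theta <= m i by apply: mm; lia.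
    by field; neq0_lra.
  have h1 : m i + theta <= m j by apply: mm; lia.
  have h2 : m' i + theta <= m' j by apply: mm'; lia.
  rewrite m'i (m'j j j0 ji) in h2.
  by field; neq0_lra.
have P1 : (\prod_(1 <= j < N.+1 | j != i) ((l' i - l' j - theta) / (l' i - l' j))) *
   (\prod_(1 <= j < N.+1 | j != i) ((l i + 1 - l j) / (l i - l j))) *
   \prod_(1 <= k < N.+1 | k != i) ((m i - l' k) / (m i - l' k + 1 - theta)) = 1.
  rewrite -!big_split/= big_nat_cond big1// => j /andP[hj ji]; have j0 : (0 < j)%N by lia.
  rewrite l'i !(l'j j j0 ji) lmi.
  have [ij|ij|ij] := ltngtP i j; last by rewrite ij eqxx in ji.
    have h1 : l j + theta <= m i by apply: ml; lia.
    by field; neq0_lra.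
  have h1 : m' i <= l' j by apply: lm2; lia.
  have h2 : l' i + theta <= l' j by apply: ll'; lia.
  rewrite m'i (l'j j j0 ji) in h1; rewrite l'i (l'j j j0 ji) lmi in h2.
  by field; neq0_lra.
have N1 : i \in index_iota 1 N by rewrite mem_index_iota; lia.
have N2 : i \in index_iota 1 N.+1 by rewrite mem_index_iota; lia.
rewrite (bigD1_seq i)/= ?iota_uniq//.
rewrite [\prod_(1 <= k < N.+1) _](bigD1_seq i)/= ?iota_uniq//.
have Y1 : (l i - m i + theta) / (l i + 1 - m i) = theta.
  by rewrite lmi; field; neq0_lra.
have Y2 : (m i - l' i) / (m i - l' i + 1 - theta) = theta^-1.
  by rewrite l'i lmi; field; neq0_lra.
rewrite Y1 Y2.
move: P1; set A := \prod_(1 <= j < N.+1 | j != i) _.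
set B := \prod_(1 <= j < N.+1 | j != i) _; set C := \prod_(1 <= j < N.+1 | j != i) _.
set E := \prod_(1 <= j < N | j != i) _; set E' := \prod_(1 <= j < N | j != i) _.
move=> P1; transitivity (A * B * C * - (theta * (E * E') * red_weight N l m)).
  by field; neq0_lra.
by rewrite P1 mul1r.
Qed.

End Weights.

(** A residue vanishes when the shift of its coordinate is prevented by a
    neighbour, because that neighbour contributes a zero numerator. *)
Section BlockedResidues.
Variables (R : realFieldType) (theta : R).
Implicit Types (l m : nat -> R).

Lemma resB_blocked N l m i : (1 < i <= N)%N -> m i.-1 = l i + theta ->
  resB theta N l m i = 0.
Proof.
move=> hi h; rewrite /resB.
rewrite (bigD1_seq i.-1)/= ?iota_uniq ?mem_index_iota; [|lia|done].
have -> : l i - m i.-1 + theta = 0 by rewrite h; ring.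
by rewrite mul0r mul0r mulr0.
Qed.

Lemma resD_blocked N l m i : (1 <= i < N)%N -> m i = l i.+1 + theta ->
  resD theta N l m i = 0.
Proof.
move=> hi h; rewrite /resD.
rewrite (bigD1_seq i.+1)/= ?iota_uniq ?mem_index_iota; [|lia|done].
have -> : m i - l i.+1 - theta = 0 by rewrite h; ring.
by rewrite !mul0r mulr0 mul0r.
Qed.

Lemma prod_nat_eq0 n j i (F : nat -> R) : (1 <= j < n)%N -> j != i -> F j = 0 ->
  \prod_(1 <= k < n | k != i) F k = 0.
Proof.
move=> hj ji Fj; apply/eqP; rewrite prodf_seq_eq0; apply/hasP; exists j.
  by rewrite mem_index_iota.
by rewrite ji Fj eqxx.
Qed.

Lemma resA_blocked N l m i : (1 <= i < N)%N -> l i = m i ->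
  m i = l i.+1 + theta -> resA theta N l i = 0.
Proof.
move=> hi lmi h; rewrite /resA (@prod_nat_eq0 _ i.+1) ?mulr0//; [lia|lia|].
by rewrite lmi h [_ + theta]addrC addrK subrr mul0r.
Qed.

Lemma resC_blocked N l m i : (1 < i < N)%N -> l i = m i ->
  m i.-1 = l i + theta -> resC theta N m i = 0.
Proof.
move=> hi lmi h; rewrite /resC (@prod_nat_eq0 _ i.-1) ?mulr0//; [lia|lia|].
have -> : m i - m i.-1 + theta = 0 by rewrite h lmi; ring.
by rewrite mul0r.
Qed.

End BlockedResidues.

Section GammaWeights.
Variables (R : realFieldType) (theta : R) (Gm : R -> R).
Hypothesis theta_gt0 : 0 < theta.
Hypothesis Gm_gt0 : forall x, 0 < x -> 0 < Gm x.
Hypothesis GmS : forall x, 0 < x -> Gm (x + 1) = x * Gm x.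
Implicit Types (l m : nat -> R).

(** The factors of two of the Gamma products with cancelling arguments leave
    a difference of coordinates. *)
Lemma gamma_pair x y : 0 < x -> 0 < y ->
  x = Gm (x + 1) / Gm y * (Gm y / Gm x).
Proof.
move=> x0 y0; rewrite (GmS x0); have := Gm_gt0 x0; have := Gm_gt0 y0.
by move: (Gm x) (Gm y) => gx gy gy0 gx0; field; rewrite !gt_eqF.
Qed.

Lemma gamma_ratioS x : 0 < x -> 0 < x - theta + 1 ->
  Gm (x + 1) / Gm (x + 1 - theta + 1) =
  Gm x / Gm (x - theta + 1) * (x / (x - theta + 1)).
Proof.
move=> x0 y0.
have -> : x + 1 - theta + 1 = (x - theta + 1) + 1 by ring.
rewrite (GmS x0) (GmS y0); move: (Gm_gt0 x0) (Gm_gt0 y0).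
move: (x - theta + 1) y0 (Gm x) => y y0 gx; move: (Gm y) => gy gx0 gy0.
by field; rewrite !gt_eqF.
Qed.

Lemma red_weight_of_gamma N l m : admissible theta N l m ->
  (\prod_(1 <= i < N.+1) \prod_(i.+1 <= j < N.+1)
     (Gm (l i - l j + 1) / Gm (l i - l j - theta + 1)))
  * (\prod_(1 <= i < N) \prod_(i.+1 <= j < N)
     (Gm (m i - m j + theta) / Gm (m i - m j)))
  * ((\prod_(1 <= i < N.+1) \prod_(i.+1 <= j < N.+1)
     (Gm (l i - l j - theta + 1) / Gm (l i - l j)))
  * (\prod_(1 <= i < N) \prod_(i.+1 <= j < N)
     (Gm (m i - m j + 1) / Gm (m i - m j + theta)))
  * (\prod_(1 <= i < N.+1) \prod_(i.+1 <= j < N.+1)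
     (Gm (m i - l j) / Gm (m i - l j - theta + 1)))
  * (\prod_(1 <= i < N) \prod_(i <= j < N)
     (Gm (l i - m j + theta) / Gm (l i - m j + 1)))) =
  red_weight theta (fun x => Gm x / Gm (x - theta + 1)) N l m.
Proof.
move=> [ll mm ml lm].
have gtE n (F : nat -> nat -> R) :
    \prod_(1 <= i < n) \prod_(i.+1 <= j < n) F i j =
    \prod_(1 <= i < n) \prod_(1 <= j < n | (i < j)%N) F i j.
  by apply: eq_bigr => i _; rewrite (@big_nat_widenl _ _ _ _ 1).
have geE n (F : nat -> nat -> R) :
    \prod_(1 <= i < n) \prod_(i <= j < n) F i j =
    \prod_(1 <= i < n) \prod_(1 <= j < n | (i <= j)%N) F i j.
  by apply: eq_big_nat => i /andP[i1 _]; rewrite (@big_nat_widenl _ _ _ _ 1).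
have E1 : \prod_(1 <= p < N.+1) \prod_(1 <= q < N.+1 | (p < q)%N) (l p - l q) =
  (\prod_(1 <= p < N.+1) \prod_(1 <= q < N.+1 | (p < q)%N)
    (Gm (l p - l q + 1) / Gm (l p - l q - theta + 1))) *
  \prod_(1 <= p < N.+1) \prod_(1 <= q < N.+1 | (p < q)%N)
    (Gm (l p - l q - theta + 1) / Gm (l p - l q)).
  apply: prod_pairM => p q hp hq pq.
  have h : l q + theta <= l p by apply: ll; lia.
  by apply: gamma_pair; move: theta_gt0 h; clear; lra.
have E2 : \prod_(1 <= p < N) \prod_(1 <= q < N | (p < q)%N) (m p - m q) =
  (\prod_(1 <= p < N) \prod_(1 <= q < N | (p < q)%N)
    (Gm (m p - m q + theta) / Gm (m p - m q))) *
  \prod_(1 <= p < N) \prod_(1 <= q < N | (p < q)%N)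
    (Gm (m p - m q + 1) / Gm (m p - m q + theta)).
  apply: prod_pairM => p q hp hq pq.
  have h : m q + theta <= m p by apply: mm; lia.
  by rewrite mulrC; apply: gamma_pair; move: theta_gt0 h; clear; lra.
rewrite !gtE geE /red_weight E1 E2.
have -> : \prod_(1 <= p < N) \prod_(1 <= q < N | (p <= q)%N)
     (Gm (l p - m q + theta) / Gm (l p - m q + theta - theta + 1)) =
   \prod_(1 <= p < N) \prod_(1 <= q < N | (p <= q)%N)
     (Gm (l p - m q + theta) / Gm (l p - m q + 1)).
  by apply: eq_bigr => p _; apply: eq_bigr => q _; rewrite addrK.
set A1 := \prod_(_ <= i < _) _; set A2 := \prod_(_ <= i < _) _.
set A3 := \prod_(_ <= i < _) _; set A4 := \prod_(_ <= i < _) _.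
set A5 := \prod_(_ <= i < _) _; set A6 := \prod_(_ <= i < _) _.
by ring.
Qed.

End GammaWeights.

(** * Raising one coordinate of a configuration *)

Section Configs.
Variables (N M : nat).
Implicit Types (c : config N M) (i j k x : nat).

(** Replace [lambda_i] by [x] (resp. [mu_i], in [setm]). The stored value is the
    [inord] of [x], meaningful for [x <= M]. *)
Definition setl c i x : config N M :=
  ([tuple if j.+1 == i then inord x else tnth c.1 j | j < N], c.2).
Definition setm c i x : config N M :=
  (c.1, [tuple if j.+1 == i then inord x else tnth c.2 j | j < N.-1]).

Lemma lam_setl c i x j : (1 <= j <= N)%N -> (x <= M)%N ->
  lam (setl c i x) j = if j == i then x else lam c j.
Proof.
move=> hj xM; have jN : (j.-1 < N)%N by lia.
rewrite /lam /setl/= (nth_mktuple _ _ (Ordinal jN))/= prednK; last by case/andP: hj.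
by case: eqP => _; rewrite ?inordK// (tnth_nth ord0).
Qed.

Lemma mu_setl c i x j : mu (setl c i x) j = mu c j. Proof. by []. Qed.

Lemma mu_setm c i x j : (1 <= j < N)%N -> (x <= M)%N ->
  mu (setm c i x) j = if j == i then x else mu c j.
Proof.
move=> hj xM; have jN : (j.-1 < N.-1)%N by lia.
rewrite /mu /setm/= (nth_mktuple _ _ (Ordinal jN))/= prednK; last by case/andP: hj.
by case: eqP => _; rewrite ?inordK// (tnth_nth ord0).
Qed.

Lemma lam_setm c i x j : lam (setm c i x) j = lam c j. Proof. by []. Qed.

Lemma lam_le c j : (lam c j <= M)%N.
Proof. by rewrite /lam -ltnS ltn_ord. Qed.

Lemma mu_le c j : (mu c j <= M)%N.
Proof. by rewrite /mu -ltnS ltn_ord. Qed.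

Lemma config_eq c d : (forall j, (1 <= j <= N)%N -> lam c j = lam d j) ->
  (forall j, (1 <= j < N)%N -> mu c j = mu d j) -> c = d.
Proof.
case: c d => [c1 c2] [d1 d2] hl hm; congr (_, _); apply: eq_from_tnth => j.
  rewrite !(tnth_nth ord0); apply: val_inj.
  by have := hl j.+1; rewrite /lam/=; apply; have := ltn_ord j; lia.
rewrite !(tnth_nth ord0); apply: val_inj.
by have := hm j.+1; rewrite /mu/=; apply; have := ltn_ord j; lia.
Qed.

Lemma interlacingP c : reflect
  (forall k, (1 <= k < N)%N -> (lam c k.+1 <= mu c k <= lam c k)%N)
  (interlacing c).
Proof.
apply: (iffP allP) => h k.
  by move=> hk; apply: h; rewrite mem_iota; lia.
by rewrite mem_iota => hk; apply: h; lia.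
Qed.

Lemma interlacing_lam c i j : interlacing c ->
  (1 <= i)%N -> (i <= j)%N -> (j <= N)%N -> (lam c j <= lam c i)%N.
Proof.
move=> /interlacingP h i1; elim: j => [|j IHj] ij jN; first lia.
have [->//|ij'] := eqVneq i j.+1.
have hj := h j; have := IHj; lia.
Qed.

Lemma interlacing_mu_lam c i j : interlacing c ->
  (1 <= i)%N -> (i <= j)%N -> (j < N)%N -> (mu c j <= lam c i)%N.
Proof.
move=> ic i1 ij jN; have /interlacingP h := ic.
have := @interlacing_lam c i j ic i1 ij; have := h j; lia.
Qed.

Lemma interlacing_lam_mu c i j : interlacing c ->
  (1 <= i)%N -> (i < j)%N -> (j <= N)%N -> (lam c j <= mu c i)%N.
Proof.
move=> ic i1 ij jN; have /interlacingP h := ic.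
have := @interlacing_lam c i.+1 j ic isT ij; have := h i; lia.
Qed.

Lemma interlacing_mu c i j : interlacing c ->
  (1 <= i)%N -> (i <= j)%N -> (j < N)%N -> (mu c j <= mu c i)%N.
Proof.
move=> ic i1 ij jN; have [->//|ij'] := eqVneq i j.
have /interlacingP h := ic.
have := @interlacing_lam_mu c i j ic i1; have := h j; lia.
Qed.

(** Reindexing a sum along a bijection between two subsets of configurations. *)
Lemma sum_partial_bij (A : nmodType) (P Q : pred (config N M)) (F : config N M -> A)
    (up down : config N M -> config N M) :
  (forall c, P c -> Q (down c) /\ up (down c) = c) ->
  (forall c, Q c -> P (up c) /\ down (up c) = c) ->
  \sum_(c | P c) F c = \sum_(c | Q c) F (up c).
Proof.
move=> hP hQ; rewrite (reindex_onto up down) => [|c /hP[]//].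
apply: eq_bigl => c; apply/andP/idP => [[Pu /eqP du]|Qc].
  by have [+ _] := hP _ Pu; rewrite du.
by have [-> ->] := hQ _ Qc.
Qed.

(** [lambda_i] cannot be lowered, resp. raised, without violating the
    interlacing or leaving [0..M]. *)
Definition low_blocked i c : bool :=
  if (i < N)%N then lam c i == mu c i else lam c i == 0%N.
Definition high_blocked i c : bool :=
  if (1 < i)%N then lam c i == mu c i.-1 else lam c i == M.

Definition raise_l i c := setl c i (lam c i).+1.
Definition lower_l i c := setl c i (lam c i).-1.
Definition raise_m i c := setm c i (mu c i).+1.
Definition lower_m i c := setm c i (mu c i).-1.

Lemma high_unblocked_lt i c : (1 <= i <= N)%N -> interlacing c -> ~~ high_blocked i c ->
  (lam c i < M)%N.
Proof.
move=> hi ic; rewrite /high_blocked; have := lam_le c i; have := mu_le c i.-1.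
case: ifP => i1; last by lia.
have := @interlacing_lam_mu c i.-1 i ic; lia.
Qed.

Lemma interlacing_raise_l i c : (1 <= i <= N)%N -> interlacing c -> ~~ high_blocked i c ->
  interlacing (raise_l i c).
Proof.
move=> hi ic bh; have lt := high_unblocked_lt hi ic bh; have /interlacingP h := ic.
apply/interlacingP => k hk; rewrite !lam_setl ?mu_setl//; try lia.
have := h k hk; move: bh lt; rewrite /high_blocked.
have [ki|ki] := eqVneq k.+1 i; first by subst i; rewrite /= (ltn_eqF (ltnSn k)); case: ifP; lia.
by have [ki2|ki2] := eqVneq k i; [rewrite ki2|]; case: ifP; lia.
Qed.

Lemma interlacing_lower_l i c : (1 <= i <= N)%N -> interlacing c -> ~~ low_blocked i c ->
  interlacing (lower_l i c) /\ (0 < lam c i)%N.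
Proof.
move=> hi ic bl; have /interlacingP h := ic.
have l0 : (0 < lam c i)%N.
  by move: bl; rewrite /low_blocked; case: ifP; [have := h i; lia|lia].
split=> //; apply/interlacingP => k hk; have := lam_le c i => lM.
rewrite !lam_setl ?mu_setl//; try lia.
have := h k hk; move: bl; rewrite /low_blocked.
have [ki|ki] := eqVneq k.+1 i; first by subst i; rewrite /= (ltn_eqF (ltnSn k)); case: ifP; lia.
by have [ki2|ki2] := eqVneq k i; [rewrite ki2|]; case: ifP; lia.
Qed.

Lemma interlacing_raise_m i c : (1 <= i < N)%N -> interlacing c -> lam c i != mu c i ->
  interlacing (raise_m i c) /\ (mu c i < M)%N.
Proof.
move=> hi ic ne; have /interlacingP h := ic; have lM := lam_le c i.
have mM : (mu c i < M)%N by have := h i; lia.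
split=> //; apply/interlacingP => k hk; rewrite !mu_setm ?lam_setm//.
have := h k hk; have [ki'|ki'] := eqVneq k i; [subst k|]; lia.
Qed.

Lemma interlacing_lower_m i c : (1 <= i < N)%N -> interlacing c -> mu c i != lam c i.+1 ->
  interlacing (lower_m i c) /\ (0 < mu c i)%N.
Proof.
move=> hi ic ne; have /interlacingP h := ic; have mM := mu_le c i.
have m0 : (0 < mu c i)%N by have := h i; lia.
split=> //; apply/interlacingP => k hk; rewrite !mu_setm ?lam_setm//; last lia.
have := h k hk; have [ki'|ki'] := eqVneq k i; [subst k|]; lia.
Qed.

Lemma lower_lK i c : (1 <= i <= N)%N -> (0 < lam c i)%N -> raise_l i (lower_l i c) = c.
Proof.
move=> hi l0; have lM := lam_le c i.
have e : lam (lower_l i c) i = (lam c i).-1 by rewrite lam_setl ?eqxx//; lia.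
apply: config_eq => j hj; last by [].
rewrite /raise_l lam_setl//; last by rewrite e; lia.
rewrite e; have [->|ji] := eqVneq j i; first lia.
by rewrite lam_setl ?(negbTE ji)//; lia.
Qed.

Lemma raise_lK i c : (1 <= i <= N)%N -> (lam c i < M)%N -> lower_l i (raise_l i c) = c.
Proof.
move=> hi lM.
have e : lam (raise_l i c) i = (lam c i).+1 by rewrite lam_setl ?eqxx.
apply: config_eq => j hj; last by [].
rewrite /lower_l lam_setl//; last by rewrite e; lia.
rewrite e; have [->|ji] := eqVneq j i; first lia.
by rewrite lam_setl ?(negbTE ji).
Qed.

Lemma lower_mK i c : (1 <= i < N)%N -> (0 < mu c i)%N -> raise_m i (lower_m i c) = c.
Proof.
move=> hi l0; have lM := mu_le c i.
have e : mu (lower_m i c) i = (mu c i).-1 by rewrite mu_setm ?eqxx//; lia.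
apply: config_eq => j hj; first by [].
rewrite /raise_m mu_setm//; last by rewrite e; lia.
rewrite e; have [->|ji] := eqVneq j i; first lia.
by rewrite mu_setm ?(negbTE ji)//; lia.
Qed.

Lemma raise_mK i c : (1 <= i < N)%N -> (mu c i < M)%N -> lower_m i (raise_m i c) = c.
Proof.
move=> hi lM.
have e : mu (raise_m i c) i = (mu c i).+1 by rewrite mu_setm ?eqxx.
apply: config_eq => j hj; first by [].
rewrite /lower_m mu_setm//; last by rewrite e; lia.
rewrite e; have [->|ji] := eqVneq j i; first lia.
by rewrite mu_setm ?(negbTE ji).
Qed.

(** Three bijections between configurations, in each of which one or two
    coordinates are raised by one. *)
Lemma sum_raise_l (A : nmodType) (F : config N M -> A) i : (1 <= i <= N)%N ->
  \sum_(c | interlacing c && ~~ low_blocked i c) F c =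
  \sum_(c | interlacing c && ~~ high_blocked i c) F (raise_l i c).
Proof.
move=> hi; apply: (@sum_partial_bij _ _ _ _ _ (lower_l i)) => c /andP[ic b].
  have [ic' l0] := interlacing_lower_l hi ic b.
  split; last exact: lower_lK.
  rewrite ic'/= /high_blocked; have lM := lam_le c i; have /interlacingP h := ic.
  rewrite !lam_setl ?eqxx ?mu_setl//; try lia.
  by case: ifP => i1; [have := h i.-1; rewrite prednK; lia|lia].
have lM := high_unblocked_lt hi ic b.
split; last exact: raise_lK.
rewrite interlacing_raise_l//= /low_blocked lam_setl ?eqxx ?mu_setl//; try lia.
by have /interlacingP h := ic; case: ifP => iN //; have := h i; lia.
Qed.

Lemma sum_raise_m (A : nmodType) (F : config N M -> A) i : (1 <= i < N)%N ->
  \sum_(c | interlacing c && (mu c i != lam c i.+1)) F c =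
  \sum_(c | interlacing c && (lam c i != mu c i)) F (raise_m i c).
Proof.
move=> hi; apply: (@sum_partial_bij _ _ _ _ _ (lower_m i)) => c /andP[ic b].
  have [ic' l0] := interlacing_lower_m hi ic b; have mM := mu_le c i.
  split; last exact: lower_mK.
  rewrite ic'/=; have /interlacingP h := ic.
  rewrite lam_setm mu_setm ?eqxx//; last lia.
  by have := h i; lia.
have [ic' lM] := interlacing_raise_m hi ic b.
split; last exact: raise_mK.
rewrite ic'/= lam_setm mu_setm ?eqxx//.
by have /interlacingP h := ic; have := h i; lia.
Qed.

Lemma sum_raise_lm (A : nmodType) (F : config N M -> A) i : (1 <= i < N)%N ->
  \sum_(c | [&& interlacing c, lam c i == mu c i & mu c i != lam c i.+1]) F c =
  \sum_(c | [&& interlacing c, lam c i == mu c i & ~~ high_blocked i c])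
     F (raise_m i (raise_l i c)).
Proof.
move=> hi; have hi' : (1 <= i <= N)%N by lia.
apply: (@sum_partial_bij _ _ _ _ _ (fun c => lower_l i (lower_m i c))) => c /and3P[ic /eqP lm b].
  have [ic' m0] := interlacing_lower_m hi ic b; have mM := mu_le c i.
  have mi : mu (lower_m i c) i = (mu c i).-1 by rewrite mu_setm ?eqxx//; lia.
  have bl : ~~ low_blocked i (lower_m i c).
    by rewrite /low_blocked mi lam_setm; case: ifP; lia.
  have [ic2 l0] := interlacing_lower_l hi' ic' bl.
  split; last by rewrite lower_lK// lower_mK.
  rewrite ic2/= mu_setl mi lam_setl ?eqxx ?lam_setm//; last lia.
  rewrite -lm eqxx /= /high_blocked lam_setl ?eqxx ?lam_setm ?mu_setl//; try lia.
  have /interlacingP h := ic; case: ifP => i1; last lia.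
  have e : (i.-1 == i) = false by lia.
  rewrite mu_setm ?e; [|lia|lia].
  by have := h i.-1; rewrite prednK; lia.
have lM := high_unblocked_lt hi' ic b.
have ic1 := interlacing_raise_l hi' ic b.
have li : lam (raise_l i c) i = (lam c i).+1 by rewrite lam_setl ?eqxx.
have b1 : lam (raise_l i c) i != mu (raise_l i c) i by rewrite li mu_setl; lia.
have [ic2 mM] := interlacing_raise_m hi ic1 b1.
split; last by rewrite raise_mK// raise_lK.
rewrite ic2/= lam_setm li mu_setm ?eqxx ?mu_setl ?lm ?eqxx//=.
rewrite lam_setm lam_setl; [|lia|lia].
have -> : (i.+1 == i) = false by lia.
by have /interlacingP h := ic; have := h i; lia.
Qed.

End Configs.

(** * The weight of a configuration *)

Section ConfigWeights.
Variables (R : realType) (N M : nat) (theta : R) (w tau : R -> R[i]).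

Lemma subn_theta i j : (i <= j <= N)%N ->
  (N - i)%:R * theta = (N - j)%:R * theta + (j - i)%:R * theta.
Proof. by move=> h; rewrite -mulrDl -natrD; congr (_%:R * _); lia. Qed.

Hypothesis theta_gt0 : 0 < theta.
Implicit Types (c : config N M) (i j : nat).

(** The factor [g] of the reduced weight. *)
Definition gamma_ratio (x : R) : R := Gamma x / Gamma (x - theta + 1).

Lemma admissible_config c : interlacing c ->
  admissible theta N (ell theta c) (emm theta c).
Proof.
have t0 := theta_gt0; move=> ic.
have tk i j : (i < j)%N -> theta <= (j - i)%:R * theta.
  by move=> ij; rewrite ler_peMl ?(ltW t0)// ler1n; lia.
split=> i j i1 ij jN; rewrite /ell /emm.
- have h := interlacing_lam ic i1 (ltnW ij) jN; have := tk i j ij.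
  by rewrite (@subn_theta i j); [|lia]; rewrite -(ler_nat R) in h; lra.
- have h := interlacing_mu ic i1 (ltnW ij) jN; have := tk i j ij.
  by rewrite (@subn_theta i j); [|lia]; rewrite -(ler_nat R) in h; lra.
- have h := interlacing_lam_mu ic i1 ij jN; have := tk i j ij.
  by rewrite (@subn_theta i j); [|lia]; rewrite -(ler_nat R) in h; lra.
- have h := interlacing_mu_lam ic i1 ij jN.
  rewrite (@subn_theta i j); [|lia]; rewrite -(ler_nat R) in h.
  have : 0 <= (j - i)%:R * theta by rewrite mulr_ge0// ltW.
  by lra.
Qed.

Notation Wc c := (red_weight theta gamma_ratio N (ell theta c) (emm theta c)).

Lemma weightE c : interlacing c ->
  weight theta w tau c = (Wc c)%:C
    * \prod_(1 <= i < N.+1) w (ell theta c i)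
    * \prod_(1 <= i < N) tau (emm theta c i).
Proof.
move=> ic.
have shuffle (a b e : R) (W T : R[i]) :
    a%:C * W * (b%:C * T) * e%:C = (a * b * e)%:C * W * T.
  by rewrite !rmorphM/=; ring.
rewrite /weight /Ht /Hb /Itb.
rewrite -(red_weight_of_gamma theta_gt0 (@Gamma_gt0 R) (@GammaS R) (admissible_config ic)).
exact: shuffle.
Qed.

End ConfigWeights.

(** * Cancellation of the residues *)

Section RaisedCoordinates.
Variables (R : realType) (N M : nat) (theta : R).
Implicit Types (c : config N M) (i j : nat).

Lemma lam_setl_neq c i x j : (0 < j)%N -> j != i -> lam (setl c i x) j = lam c j.
Proof.
move=> j0 ji; have [jN|jN] := leqP j N; last first.
  by rewrite /lam !nth_default// size_tuple; lia.
have jN' : (j.-1 < N)%N by lia.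
rewrite /lam /setl/= (nth_mktuple _ _ (Ordinal jN'))/= prednK// (negbTE ji).
by rewrite (tnth_nth ord0).
Qed.

Lemma mu_setm_neq c i x j : (0 < j)%N -> j != i -> mu (setm c i x) j = mu c j.
Proof.
move=> j0 ji; have [jN|jN] := leqP j N.-1; last first.
  by rewrite /mu !nth_default// size_tuple; lia.
have jN' : (j.-1 < N.-1)%N by lia.
rewrite /mu /setm/= (nth_mktuple _ _ (Ordinal jN'))/= prednK// (negbTE ji).
by rewrite (tnth_nth ord0).
Qed.

Lemma ell_raise_l c i : (1 <= i <= N)%N -> (lam c i < M)%N ->
  ell theta (raise_l i c) i = ell theta c i + 1.
Proof.
by move=> hi lM; rewrite /ell lam_setl// eqxx -natr1; ring.
Qed.

Lemma ell_raise_l_neq c i j : (0 < j)%N -> j != i ->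
  ell theta (raise_l i c) j = ell theta c j.
Proof. by move=> j0 ji; rewrite /ell lam_setl_neq. Qed.

Lemma emm_raise_m c i : (1 <= i < N)%N -> (mu c i < M)%N ->
  emm theta (raise_m i c) i = emm theta c i + 1.
Proof.
by move=> hi lM; rewrite /emm mu_setm// eqxx -natr1; ring.
Qed.

Lemma emm_raise_m_neq c i j : (0 < j)%N -> j != i ->
  emm theta (raise_m i c) j = emm theta c j.
Proof. by move=> j0 ji; rewrite /emm mu_setm_neq. Qed.

End RaisedCoordinates.

Lemma prod_update (T : Type) (K : comNzRingType) (f : T -> K) (x y : nat -> T) n i :
  (1 <= i < n)%N -> (forall j, (0 < j)%N -> j != i -> y j = x j) ->
  \prod_(1 <= j < n) f (y j) = f (y i) * \prod_(1 <= j < n | j != i) f (x j).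
Proof.
move=> hi yx; rewrite (bigD1_seq i) ?mem_index_iota ?iota_uniq//=; congr (_ * _).
rewrite big_nat_cond [RHS]big_nat_cond; apply: eq_bigr => j /andP[/andP[j0 _] ji].
by rewrite yx.
Qed.

Lemma step_theta (R : realType) (N : nat) (theta : R) i (x y : nat) : (1 < i <= N)%N -> x = y ->
  x%:R + (N - i.-1)%:R * theta = y%:R + (N - i)%:R * theta + theta :> R.
Proof.
move=> hi ->; have -> : (N - i.-1 = (N - i).+1)%N by lia.
by rewrite -natr1; ring.
Qed.

Lemma gamma_ratio_recurrence (R : realType) (theta x : R) :
  0 < x -> 0 < x - theta + 1 ->
  gamma_ratio theta (x + 1) = gamma_ratio theta x * (x / (x - theta + 1)).
Proof. by move=> x0 y0; exact: gamma_ratioS (@Gamma_gt0 R) (@GammaS R) _ _ _. Qed.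

Section Pairings.
Variables (R : realType) (N M : nat) (theta : R) (w tau : R -> R[i]).
Variables (phit phib phim : R[i] -> R[i]) (h : R[i] -> R[i]).
Hypothesis theta_gt0 : 0 < theta.
Hypothesis theta_neq1 : theta != 1.
Hypothesis N_ge2 : (2 <= N)%N.
Hypothesis ratio_t : forall x : R, 1 <= x <= M%:R + N.-1%:R * theta ->
  phit x%:C * w x = phim x%:C * w (x - 1).
Hypothesis ratio_b : forall x : R, theta + 1 <= x <= M%:R + N.-1%:R * theta ->
  phib x%:C * tau (x - 1) = phim x%:C * tau x.
Implicit Types (c : config N M) (i j : nat).

Local Notation l := (ell theta).
Local Notation m := (emm theta).
Local Notation th := (theta%:C).
Local Notation Pr c := (prob theta w tau c).
Local Notation kappa := (th / (1 - th)).

Lemma kappaE : kappa = (theta / (1 - theta))%:C.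
Proof. by rewrite rmorphM fmorphV rmorphB rmorph1. Qed.

Lemma ell_itv c i : (1 <= i <= N)%N -> (0 < lam c i)%N ->
  1 <= l c i <= M%:R + N.-1%:R * theta.
Proof.
have t0 := theta_gt0; move=> hi l0; have lM := lam_le c i; rewrite /ell.
have h1 : 0 <= (N - i)%:R * theta by rewrite mulr_ge0// ltW.
have h2 : (N - i)%:R * theta <= N.-1%:R * theta.
  by rewrite ler_wpM2r ?(ltW t0)// ler_nat; lia.
rewrite -(ler_nat R) in lM; rewrite -(ltr_nat R) ltr0n -(ler_nat R) in l0.
by lra.
Qed.

Lemma emm_itv c i : (1 <= i < N)%N -> (0 < mu c i)%N ->
  theta + 1 <= m c i <= M%:R + N.-1%:R * theta.
Proof.
have t0 := theta_gt0; move=> hi l0; have lM := mu_le c i; rewrite /emm.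
have h1 : theta <= (N - i)%:R * theta.
  by rewrite ler_peMl ?(ltW t0)// ler1n; lia.
have h2 : (N - i)%:R * theta <= N.-1%:R * theta.
  by rewrite ler_wpM2r ?(ltW t0)// ler_nat; lia.
rewrite -(ler_nat R) in lM; rewrite -(ler_nat R) in l0.
by lra.
Qed.

(** The pairing of residues with the weights [w] and [tau] and the ratios of the
    [phi]'s taken into account. *)
Lemma pair_l c i : (1 <= i <= N)%N -> interlacing c -> ~~ high_blocked i c ->
  (resA theta N (l (raise_l i c)) i)%:C * Pr (raise_l i c) * phit (l (raise_l i c) i)%:C =
  - (kappa * (resB theta N (l c) (m c) i)%:C * Pr c * phim (l c i + 1)%:C).
Proof.
move=> hi ic b; have lM := high_unblocked_lt hi ic b.
have ic' := interlacing_raise_l hi ic b.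
have ei := ell_raise_l theta hi lM.
have ej j := @ell_raise_l_neq R N M theta c i j.
have real := resA_resB theta_gt0 theta_neq1 (@gamma_ratio_recurrence R theta)
  hi (admissible_config theta_gt0 ic) (admissible_config theta_gt0 ic') ei ej.
have hi1 : (1 <= i < N.+1)%N by lia.
rewrite /prob (weightE w tau theta_gt0 ic) (weightE w tau theta_gt0 ic').
rewrite (prod_update w hi1 ej) (@prod_update _ _ w (l c) (l c) _ _ hi1)//.
have l0 : (0 < lam (raise_l i c) i)%N by rewrite lam_setl ?eqxx.
have := ratio_t (ell_itv hi l0); rewrite ei addrK => e2.
have cast (D V k C V' : R) : D * V = - (k * C * V') ->
    D%:C * V%:C = - (k%:C * C%:C * V'%:C).
  by move=> e; rewrite -!rmorphM e rmorphN.
have e1 := cast _ _ _ _ _ real; rewrite -kappaE in e1.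
have shuffle (A V' k B V Z P T w0 w1 p q : R[i]) :
    A * V' = - (k * B * V) -> p * w1 = q * w0 ->
    A * (Z * (V' * (w1 * P) * T)) * p = - (k * B * (Z * (V * (w0 * P) * T)) * q).
  move=> h1 h2; transitivity (A * V' * Z * P * T * (p * w1)); first by ring.
  by rewrite h1 h2; ring.
exact: shuffle e1 e2.
Qed.

Lemma pair_m c i : (1 <= i < N)%N -> interlacing c -> lam c i != mu c i ->
  kappa * (resD theta N (l (raise_m i c)) (m (raise_m i c)) i)%:C * Pr (raise_m i c)
    * phim (m (raise_m i c) i)%:C =
  - ((resC theta N (m c) i)%:C * Pr c * phib (m c i + 1)%:C).
Proof.
move=> hi ic b; have [ic' lM] := interlacing_raise_m hi ic b.
have ei := emm_raise_m theta hi lM.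
have ej j := @emm_raise_m_neq R N M theta c i j.
have al' : admissible theta N (l c) (m (raise_m i c)) := admissible_config theta_gt0 ic'.
have real := resD_resC theta_gt0 theta_neq1 (@gamma_ratio_recurrence R theta)
  hi (admissible_config theta_gt0 ic) al' ei ej.
rewrite /prob (weightE w tau theta_gt0 ic) (weightE w tau theta_gt0 ic').
rewrite (prod_update tau hi ej) (@prod_update _ _ tau (m c) (m c) _ _ hi)//.
have l0 : (0 < mu (raise_m i c) i)%N by rewrite mu_setm ?eqxx.
have := ratio_b (emm_itv hi l0); rewrite ei addrK => e2.
have cast (k D V C V' : R) : k * D * V = - (C * V') ->
    k%:C * D%:C * V%:C = - (C%:C * V'%:C).
  by move=> e; rewrite -!rmorphM e rmorphN.
have e1 := cast _ _ _ _ _ real; rewrite -kappaE in e1.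
have shuffle (D V' k C V Z P T t0 t1 p q : R[i]) :
    k * D * V' = - (C * V) -> p * t0 = q * t1 ->
    k * D * (Z * (V' * T * (t1 * P))) * q = - (C * (Z * (V * T * (t0 * P))) * p).
  move=> h1 h2; transitivity (k * D * V' * Z * P * T * (q * t1)); first by ring.
  by rewrite h1 -h2; ring.
exact: shuffle e1 e2.
Qed.

Lemma pair_lm c i : (1 <= i < N)%N -> interlacing c -> lam c i = mu c i ->
  ~~ high_blocked i c ->
  (resA theta N (l (raise_m i (raise_l i c))) i)%:C * Pr (raise_m i (raise_l i c))
    * phit (l (raise_m i (raise_l i c)) i)%:C =
  - ((resC theta N (m c) i)%:C * Pr c * phib (m c i + 1)%:C).
Proof.
move=> hi ic lm b; have hi' : (1 <= i <= N)%N by lia.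
have lM := high_unblocked_lt hi' ic b; have ic1 := interlacing_raise_l hi' ic b.
have b1 : lam (raise_l i c) i != mu (raise_l i c) i by rewrite mu_setl lam_setl// eqxx; lia.
have [ic2 mM] := interlacing_raise_m hi ic1 b1.
have ei := ell_raise_l theta hi' lM; have ej j := @ell_raise_l_neq R N M theta c i j.
have mi := emm_raise_m theta hi mM; have mj j := @emm_raise_m_neq R N M theta (raise_l i c) i j.
have al1 : admissible theta N (l (raise_l i c)) (m c) := admissible_config theta_gt0 ic1.
have al2 : admissible theta N (l (raise_l i c)) (m (raise_m i (raise_l i c))) :=
  admissible_config theta_gt0 ic2.
have lmE : l c i = m c i by rewrite /ell /emm lm.
have real := resA_resC theta_gt0 theta_neq1 (@gamma_ratio_recurrence R theta)
  hi (admissible_config theta_gt0 ic) al1 al2 lmE ei ej mi mj.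
have hi1 : (1 <= i < N.+1)%N by lia.
rewrite /prob (weightE w tau theta_gt0 ic) (weightE w tau theta_gt0 ic2).
rewrite (prod_update w hi1 ej) (@prod_update _ _ w (l c) (l c) _ _ hi1)//.
rewrite (prod_update tau hi mj) (@prod_update _ _ tau (m c) (m c) _ _ hi)//.
have l0 : (0 < lam (raise_l i c) i)%N by rewrite lam_setl ?eqxx.
have ei' : l (raise_m i (raise_l i c)) i = l c i + 1 := ei.
have mi' : m (raise_m i (raise_l i c)) i = m c i + 1 := mi.
have := ratio_t (ell_itv hi' l0); rewrite ei addrK => e2.
have m0 : (0 < mu (raise_m i (raise_l i c)) i)%N by rewrite mu_setm ?eqxx.
have := ratio_b (emm_itv hi m0); rewrite mi' addrK => e3.
have cast (D V C V' : R) : D * V = - (C * V') -> D%:C * V%:C = - (C%:C * V'%:C).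
  by move=> e; rewrite -!rmorphM e rmorphN.
have e1 := cast _ _ _ _ real.
have shuffle (A V' C V Z P T w0 w1 t0 t1 p q r : R[i]) :
    A * V' = - (C * V) -> p * w1 = q * w0 -> r * t0 = q * t1 ->
    A * (Z * (V' * (w1 * P) * (t1 * T))) * p =
    - (C * (Z * (V * (w0 * P) * (t0 * T))) * r).
  move=> h1 h2 h3; transitivity (A * V' * Z * P * T * (p * w1) * t1); first by ring.
  rewrite h1 h2; transitivity (- (C * V * Z * P * T * (q * t1) * w0)); first by ring.
  by rewrite -h3; ring.
rewrite ?ei' -lmE in e3 *.
exact: shuffle e1 e2 e3.
Qed.

(** The contribution of a configuration and an index to the sum of the residues
    of [R1], tested against a function [h]. *)
Definition termA i c : R[i] := (resA theta N (l c) i)%:C * Pr c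
  * phit (l c i)%:C * h (l c i)%:C.
Definition termB i c : R[i] := kappa * (resB theta N (l c) (m c) i)%:C * Pr c
  * phim (l c i + 1)%:C * h (l c i + 1)%:C.
Definition termC i c : R[i] := (resC theta N (m c) i)%:C * Pr c
  * phib (m c i + 1)%:C * h (m c i + 1)%:C.
Definition termD i c : R[i] := kappa * (resD theta N (l c) (m c) i)%:C * Pr c
  * phim (m c i)%:C * h (m c i)%:C.

Lemma cancel_l i : (1 <= i <= N)%N ->
  \sum_(c | interlacing c && ~~ low_blocked i c) termA i c +
  \sum_(c | interlacing c && ~~ high_blocked i c) termB i c = 0.
Proof.
move=> hi; rewrite sum_raise_l// -big_split/= big1// => c /andP[ic b].
rewrite /termA (pair_l hi ic b) (ell_raise_l theta hi (high_unblocked_lt hi ic b)).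
by rewrite -mulrDl /termB addNr mul0r.
Qed.

Lemma cancel_m i : (1 <= i < N)%N ->
  \sum_(c | interlacing c && (mu c i != lam c i.+1)) termD i c +
  \sum_(c | interlacing c && (lam c i != mu c i)) termC i c = 0.
Proof.
move=> hi; rewrite sum_raise_m// -big_split/= big1// => c /andP[ic b].
have [_ mM] := interlacing_raise_m hi ic b.
rewrite /termD (pair_m hi ic b) (emm_raise_m theta hi mM).
by rewrite -mulrDl /termC addNr mul0r.
Qed.

Lemma cancel_lm i : (1 <= i < N)%N ->
  \sum_(c | [&& interlacing c, lam c i == mu c i & mu c i != lam c i.+1])
     termA i c +
  \sum_(c | [&& interlacing c, lam c i == mu c i & ~~ high_blocked i c]) termC i c = 0.
Proof.
move=> hi; rewrite sum_raise_lm// -big_split/= big1// => c /and3P[ic /eqP lm b].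
have hi' : (1 <= i <= N)%N by lia.
rewrite /termA (pair_lm hi ic lm b).
have -> : l (raise_m i (raise_l i c)) i = m c i + 1.
  have -> : l (raise_m i (raise_l i c)) i = l c i + 1.
    exact: (ell_raise_l theta hi' (high_unblocked_lt hi' ic b)).
  by rewrite /ell /emm lm.
by rewrite /termC mulNr addNr.
Qed.

Lemma termB_blocked i c : (1 < i <= N)%N -> high_blocked i c -> termB i c = 0.
Proof.
move=> hi; rewrite /high_blocked; have -> : (1 < i)%N by lia.
move=> /eqP lm; rewrite /termB resB_blocked ?mulr0 ?mul0r//.
by apply: step_theta.
Qed.

Lemma termD_blocked i c : (1 <= i < N)%N -> mu c i = lam c i.+1 -> termD i c = 0.
Proof.
move=> hi lm; rewrite /termD resD_blocked ?mulr0 ?mul0r//.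
by rewrite /emm /ell -(@step_theta R N theta i.+1 (mu c i))//; lia.
Qed.

Lemma termA_blocked i c : (1 <= i < N)%N -> lam c i = mu c i ->
  mu c i = lam c i.+1 -> termA i c = 0.
Proof.
move=> hi lm ml; rewrite /termA (@resA_blocked _ _ _ _ (m c)) ?mul0r//.
  by rewrite /ell /emm lm.
by rewrite /emm /ell -(@step_theta R N theta i.+1 (mu c i))//; lia.
Qed.

Lemma termC_blocked i c : (1 < i < N)%N -> lam c i = mu c i -> high_blocked i c ->
  termC i c = 0.
Proof.
move=> hi lm; rewrite /high_blocked; have -> : (1 < i)%N by lia.
move=> /eqP ml; rewrite /termC (@resC_blocked _ _ _ (l c)) ?mul0r//.
  by rewrite /ell /emm lm.
by apply: step_theta => //; lia.
Qed.

(** The sum of all residues, tested against [h]. *)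
Lemma residue_sum :
  \sum_(1 <= i < N.+1) \sum_(c | interlacing c) (termA i c + termB i c) +
  \sum_(1 <= i < N) \sum_(c | interlacing c) (termC i c + termD i c) =
  \sum_(c | interlacing c && (lam c N == 0%N)) termA N c +
  \sum_(c | interlacing c && (lam c 1 == M)) termB 1 c +
  \sum_(c | interlacing c && (mu c 1 == M)) termC 1 c.
Proof.
have AB i : (1 <= i <= N)%N ->
    \sum_(c | interlacing c) (termA i c + termB i c) =
    \sum_(c | interlacing c && low_blocked i c) termA i c +
    \sum_(c | interlacing c && high_blocked i c) termB i c.
  move=> hi; rewrite big_split/= (bigID (low_blocked i))/= [X in _ + X](bigID (high_blocked i))/=.
  by rewrite addrACA [X in _ + X = _](cancel_l hi) addr0.
have CD i : (1 <= i < N)%N ->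
    \sum_(c | interlacing c) (termC i c + termD i c) =
    \sum_(c | interlacing c && (lam c i == mu c i)) termC i c.
  move=> hi; rewrite big_split/= (bigID (fun c => lam c i == mu c i))/=.
  rewrite [X in _ + X](bigID (fun c => mu c i == lam c i.+1))/=.
  rewrite [X in _ + (X + _)]big1 ?add0r => [|c /andP[_ /eqP ml]]; last first.
    exact: termD_blocked.
  by rewrite -addrA [X in _ + X]addrC (cancel_m hi) addr0.
have bB i : (1 < i <= N)%N -> \sum_(c | interlacing c && high_blocked i c) termB i c = 0.
  by move=> hi; rewrite big1// => c /andP[_]; exact: termB_blocked.
have ABCD i : (1 <= i < N)%N ->
    \sum_(c | interlacing c && low_blocked i c) termA i c +
    \sum_(c | interlacing c && (lam c i == mu c i)) termC i c =
    \sum_(c | [&& interlacing c, lam c i == mu c i & high_blocked i c]) termC i c.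
  move=> hi.
  have -> : \sum_(c | interlacing c && low_blocked i c) termA i c =
    \sum_(c | [&& interlacing c, lam c i == mu c i & mu c i != lam c i.+1])
     termA i c.
    rewrite (bigID (fun c => mu c i == lam c i.+1))/= big1 ?add0r.
      by apply: eq_bigl => c; rewrite /low_blocked ifT ?andbA//; lia.
    move=> c /andP[/andP[_ b] /eqP ml]; apply: termA_blocked => //.
    by move: b; rewrite /low_blocked ifT; [move/eqP|lia].
  rewrite [X in _ + X](bigID (high_blocked i))/= addrCA.
  have -> : \sum_(c | interlacing c && (lam c i == mu c i) && ~~ high_blocked i c) termC i c =
    \sum_(c | [&& interlacing c, lam c i == mu c i & ~~ high_blocked i c]) termC i c.
    by apply: eq_bigl => c; rewrite andbA.
  by rewrite (cancel_lm hi) addr0; apply: eq_bigl => c; rewrite andbA.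
rewrite big_nat_recr/=; last by lia.
rewrite AB ?bB ?addr0; [|lia..].
rewrite -addrA [X in _ + X]addrC addrA -big_split/=.
have -> : \sum_(1 <= i < N)
   (\sum_(c | interlacing c) (termA i c + termB i c) +
    \sum_(c | interlacing c) (termC i c + termD i c)) =
   \sum_(1 <= i < N) (if i == 1%N then
     \sum_(c | interlacing c && (lam c 1 == M)) termB 1 c +
     \sum_(c | interlacing c && (mu c 1 == M)) termC 1 c else 0).
  apply: eq_big_nat => i hi; rewrite AB ?CD//; last by lia.
  rewrite addrAC ABCD//; have [->|i1] := eqVneq i 1%N; last first.
    rewrite bB ?addr0; last by lia.
    rewrite big1// => c /and3P[_ /eqP lm]; apply: termC_blocked => //; lia.
  rewrite addrC; congr (_ + _).
  apply: eq_bigl => c; rewrite /high_blocked /=; case ic: (interlacing c) => //=.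
  have /interlacingP/(_ 1%N) := ic; have := lam_le c 1; have := mu_le c 1.
  by move: (lam c 1) (mu c 1) => x y; lia.
rewrite (@big_ltn _ _ _ 1 N)// big_nat [\sum_(2 <= i < N | _) _]big1 => [|i]; last first.
  by case: eqP => // ->; rewrite ltnn.
rewrite addr0 addrC addrA; congr (_ + _ + _).
by apply: eq_bigl => c; rewrite /low_blocked ltnn.
Qed.


Lemma prod_drop_last (F : nat -> R) :
  \prod_(1 <= j < N.+1 | j != N) F j = \prod_(1 <= j < N) F j.
Proof.
rewrite big_mkcond big_nat_recr/=; last by lia.
by rewrite eqxx mulr1; apply: eq_big_nat => j hj; rewrite ifT//; lia.
Qed.

Lemma prod_drop_first n (F : nat -> R) : (1 < n)%N ->
  \prod_(1 <= j < n | j != 1%N) F j = \prod_(2 <= j < n) F j.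
Proof.
move=> n1; rewrite big_mkcond big_ltn//= mul1r.
by apply: eq_big_nat => j hj; rewrite ifT//; lia.
Qed.

Lemma real_complex_div (x y : R) : (x / y)%:C = x%:C / y%:C.
Proof. by rewrite rmorphM fmorphV. Qed.

Lemma ellN_is0E c : ellN_is0 theta c = (lam c N == 0%N).
Proof. by rewrite /ellN_is0 /ell subnn mul0r addr0 pnatr_eq0. Qed.

Lemma ell1_is_maxE c : ell1_is_max theta c = (lam c 1 == M).
Proof.
rewrite /ell1_is_max /ell /sN subn1.
have -> : M%:R + 1 + N.-1%:R * theta - 1 = M%:R + N.-1%:R * theta by ring.
by rewrite (inj_eq (addIr _)) eqr_nat.
Qed.

Lemma m1_is_maxE c : m1_is_max theta c = (mu c 1 == M).
Proof.
rewrite /m1_is_max /emm /sN subn1.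
have -> : M%:R + 1 + N.-1%:R * theta - 1 = M%:R + N.-1%:R * theta by ring.
by rewrite (inj_eq (addIr _)) eqr_nat.
Qed.

Lemma boundary_ellN :
  \sum_(c | interlacing c && (lam c N == 0%N)) termA N c =
  r1_minus N M theta w tau phit * h 0.
Proof.
rewrite /r1_minus /expect_on /expect big_mkcondr mulr_sumr mulr_suml.
apply: eq_bigr => c ic; rewrite ellN_is0E; case: eqP => [l0|_]; last first.
  by rewrite mulr0 mul0r mulr0 mul0r.
have e0 : l c N = 0 by rewrite /ell l0 subnn mul0r addr0.
rewrite /termA e0 mulr1 /resA prod_drop_last e0 rmorphM rmorphN rmorph_prod/=.
have -> : \prod_(1 <= j < N) ((0 - l c j - theta) / (0 - l c j))%:C =
    \prod_(1 <= i < N) (((l c i)%:C + th) / (l c i)%:C).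
  apply: eq_bigr => j _; rewrite sub0r -opprD invrN mulrNN.
  by rewrite real_complex_div rmorphD.
by move: (\prod_(1 <= i < N) _) (phit _) (h _) (prob _ _ _ _) => a b e f; ring.
Qed.

Lemma boundary_ell1_m1 :
  \sum_(c | interlacing c && (lam c 1 == M)) termB 1 c +
  \sum_(c | interlacing c && (mu c 1 == M)) termC 1 c =
  r1_plus N M theta w tau phib phim * h (sN N M theta)%:C.
Proof.
rewrite /r1_plus /expect_on /expect mulrDl; congr (_ + _).
  rewrite big_mkcondr mulr_sumr mulr_suml.
  apply: eq_bigr => c ic; rewrite ell1_is_maxE; case: eqP => [l0|_]; last first.
    by rewrite mulr0 mul0r mulr0 mul0r.
  have e0 : l c 1 + 1 = sN N M theta by rewrite /ell l0 /sN subn1; ring.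
  have e1 : l c 1 = sN N M theta - 1 by rewrite -e0 addrK.
  rewrite /termB e0 mulr1 /resB prod_drop_first; last by lia.
  rewrite !rmorphM !rmorph_prod/= e0 e1.
  have -> : \prod_(2 <= j < N.+1)
      ((sN N M theta - l c j - theta) / (sN N M theta - 1 - l c j))%:C =
      \prod_(2 <= i < N.+1) (((sN N M theta)%:C - (l c i)%:C - th) /
        ((sN N M theta)%:C - (l c i)%:C - 1)).
    apply: eq_bigr => j _; rewrite real_complex_div [sN _ _ _ - 1 - _]addrAC.
    by rewrite !rmorphB rmorph1.
  have -> : \prod_(1 <= j < N)
      ((sN N M theta - 1 - m c j + theta) / (sN N M theta - m c j))%:C =
      \prod_(1 <= i < N) (((sN N M theta)%:C - (m c i)%:C + th - 1) /
        ((sN N M theta)%:C - (m c i)%:C)).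
    apply: eq_bigr => j _; rewrite real_complex_div [sN _ _ _ - 1 - _]addrAC.
    by rewrite [_ - 1 + theta]addrAC rmorphB rmorphD !rmorphB rmorph1.
  move: (\prod_(2 <= i < _) _) (\prod_(1 <= i < N) _) => a b.
  move: (phim _) (h _) (prob _ _ _ _) => d e f; rewrite rmorphB rmorph1 /=.
  have k0 : 1 - th != 0.
    by rewrite -(rmorph1 (real_complex R)) -rmorphB/= fmorph_eq0 subr_eq0 eq_sym.
  by move: th k0 => t k0; field.
rewrite big_mkcondr mulr_sumr mulr_suml.
apply: eq_bigr => c ic; rewrite m1_is_maxE; case: eqP => [l0|_]; last first.
  by rewrite mulr0 mul0r mulr0 mul0r.
have e0 : m c 1 + 1 = sN N M theta by rewrite /emm l0 /sN subn1; ring.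
have e1 : m c 1 = sN N M theta - 1 by rewrite -e0 addrK.
rewrite /termC e0 mulr1 /resC prod_drop_first; last by lia.
rewrite !rmorphM !rmorph_prod/= e1.
have -> : \prod_(2 <= j < N)
    ((sN N M theta - 1 - m c j + theta) / (sN N M theta - 1 - m c j))%:C =
    \prod_(2 <= i < N) (((sN N M theta)%:C - (m c i)%:C + th - 1) /
      ((sN N M theta)%:C - (m c i)%:C - 1)).
  apply: eq_bigr => j _; rewrite real_complex_div [sN _ _ _ - 1 - _]addrAC.
  by rewrite [_ - 1 + theta]addrAC !rmorphB rmorphD !rmorphB rmorph1.
by move: (\prod_(2 <= i < _) _) (phib _) (h _) (prob _ _ _ _) => a d e f; ring.
Qed.

End Pairings.

(** * Partial fraction expansions of the three products *)

Section ConfigPartialFractions.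
Variables (R : realType) (N M : nat) (theta : R).
Hypothesis theta_gt0 : 0 < theta.
Implicit Types (c : config N M) (i j : nat) (z : R[i]).

Local Notation l := (ell theta).
Local Notation m := (emm theta).
Local Notation th := (theta%:C).

Lemma realC_inj : injective (fun x : R => x%:C).
Proof. by move=> x y []. Qed.

Lemma ell_inj c i j : interlacing c -> (1 <= i <= N)%N -> (1 <= j <= N)%N ->
  l c i = l c j -> i = j.
Proof.
have t0 := theta_gt0; move=> /(admissible_config t0)[ll _ _ _] hi hj e.
have [ij|ij|//] := ltngtP i j.
  have h : l c j + theta <= l c i by apply: ll; lia.
  by exfalso; move: t0 h e; clear; lra.
have h : l c i + theta <= l c j by apply: ll; lia.
by exfalso; move: t0 h e; clear; lra.
Qed.

Lemma emm_inj c i j : interlacing c -> (1 <= i < N)%N -> (1 <= j < N)%N ->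
  m c i = m c j -> i = j.
Proof.
have t0 := theta_gt0; move=> /(admissible_config t0)[_ mm _ _] hi hj e.
have [ij|ij|//] := ltngtP i j.
  have h : m c j + theta <= m c i by apply: mm; lia.
  by exfalso; move: t0 h e; clear; lra.
have h : m c i + theta <= m c j by apply: mm; lia.
by exfalso; move: t0 h e; clear; lra.
Qed.

(** An unblocked pole [l_i + 1] of the third product is not one of the [m_j]. *)
Lemma ell_succ_neq_emm c i j : interlacing c -> (1 <= i <= N)%N -> (1 <= j < N)%N ->
  ((1 < i)%N -> lam c i != mu c i.-1) -> l c i + 1 <> m c j.
Proof.
have t0 := theta_gt0; move=> ic hi hj nb e.
have [ij|ij] := leqP i j.
  have [_ _ _ lm] := admissible_config t0 ic.
  have h : m c j <= l c i by apply: lm; lia.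
  by move: h e; clear; lra.
have i1 : (1 < i)%N by lia.
have h1 : (mu c i.-1 <= mu c j)%N by apply: interlacing_mu ic _ _ _; lia.
have h2 : (lam c i <= mu c i.-1)%N by apply: interlacing_lam_mu ic _ _ _; lia.
have h3 : ((lam c i).+1 <= mu c j)%N by have := nb i1; lia.
move: e; rewrite /ell /emm (@subn_theta R N theta j i); [|lia].
have h4 : theta <= (i - j)%:R * theta by rewrite ler_peMl ?(ltW t0)// ler1n; lia.
by rewrite -(ler_nat R) -natr1 in h3; move: t0 h3 h4; clear; lra.
Qed.

(** An unblocked pole [m_i] of the third product is not one of the [l_j + 1]. *)
Lemma emm_neq_ell_succ c i j : interlacing c -> (1 <= i < N)%N -> (1 <= j <= N)%N ->
  lam c i.+1 != mu c i -> m c i <> l c j + 1.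
Proof.
have t0 := theta_gt0; move=> ic hi hj nb e.
have [ij|ij] := leqP j i.
  have [_ _ _ lm] := admissible_config t0 ic.
  have h : m c i <= l c j by apply: lm; lia.
  by move: h e; clear; lra.
have h1 : (lam c j <= lam c i.+1)%N by apply: interlacing_lam ic _ _ _; lia.
have h2 : (lam c i.+1 <= mu c i)%N by apply: interlacing_lam_mu ic _ _ _; lia.
have h3 : ((lam c j).+1 <= mu c i)%N by lia.
move: e; rewrite /ell /emm (@subn_theta R N theta i j); [|lia].
have h4 : theta <= (j - i)%:R * theta by rewrite ler_peMl ?(ltW t0)// ler1n; lia.
by rewrite -(ler_nat R) -natr1 in h3; move: t0 h3 h4; clear; lra.
Qed.

Lemma expansion_top c z : interlacing c ->
  (forall i, (1 <= i <= N)%N -> z != (l c i)%:C) ->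
  \prod_(1 <= i < N.+1) ((z - (l c i)%:C - th) / (z - (l c i)%:C)) =
  1 + \sum_(1 <= i < N.+1) (resA theta N (l c) i)%:C / (z - (l c i)%:C).
Proof.
move=> ic hz.
have := @partial_fractions _ _ (fun i => (l c i)%:C + th) (fun i => (l c i)%:C)
  (index_iota 1 N.+1) z (iota_uniq _ _).
under eq_bigr do rewrite opprD addrA.
move=> ->; last 2 first.
- move=> i j; rewrite !mem_index_iota => hi hj /realC_inj; apply: ell_inj ic _ _; lia.
- by move=> i; rewrite mem_index_iota => hi; apply: hz; lia.
congr (1 + _); apply: eq_bigr => i _; congr (_ / _).
rewrite /resA rmorphM rmorphN rmorph_prod/= opprD addrA subrr sub0r; congr (_ * _).
apply: eq_bigr => j _; rewrite real_complex_div !rmorphB/=.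
by rewrite opprD addrA.
Qed.

Lemma expansion_bottom c z : interlacing c ->
  (forall i, (1 <= i < N)%N -> z != (m c i + 1)%:C) ->
  \prod_(1 <= i < N) ((z - (m c i)%:C + th - 1) / (z - (m c i)%:C - 1)) =
  1 + \sum_(1 <= i < N) (resC theta N (m c) i)%:C / (z - (m c i + 1)%:C).
Proof.
move=> ic hz.
have := @partial_fractions _ _ (fun i => (m c i + 1 - theta)%:C) (fun i => (m c i + 1)%:C)
  (index_iota 1 N) z (iota_uniq _ _).
have -> : \prod_(i <- index_iota 1 N)
    ((z - (m c i + 1 - theta)%:C) / (z - (m c i + 1)%:C)) =
    \prod_(1 <= i < N) ((z - (m c i)%:C + th - 1) / (z - (m c i)%:C - 1)).
  apply: eq_bigr => i _; rewrite rmorphB rmorphD rmorph1/=.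
  by congr (_ / _); ring.
move=> ->; last 2 first.
- move=> i j; rewrite !mem_index_iota => hi hj /realC_inj/addIr; apply: emm_inj ic _ _; lia.
- by move=> i; rewrite mem_index_iota => hi; apply: hz; lia.
congr (1 + _); apply: eq_bigr => i _; congr (_ / _).
rewrite /resC rmorphM rmorph_prod/= -rmorphB/=; congr (_%:C * _); first by ring.
apply: eq_bigr => j _; rewrite real_complex_div -!rmorphB/=.
by congr (_%:C / _%:C); ring.
Qed.

(** Indices, poles and zeros of the third product: [(true, i)] stands for [l_i]
    and [(false, i)] for [m_i]. *)
Definition mixed_idx : seq (bool * nat) :=
  [seq (true, i) | i <- index_iota 1 N.+1] ++
  [seq (false, i) | i <- index_iota 1 N].

Definition mixed_pole c (k : bool * nat) : R :=
  if k.1 then l c k.2 + 1 else m c k.2.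
Definition mixed_zero c (k : bool * nat) : R :=
  if k.1 then l c k.2 + theta else m c k.2 + 1 - theta.

(** The factors of [l_(i+1)] and [m_i] cancel when [lambda_(i+1) = mu_i]. *)
Definition mixed_blocked c (k : bool * nat) : bool :=
  if k.1 then (1 < k.2)%N && (lam c k.2 == mu c k.2.-1)
  else lam c k.2.+1 == mu c k.2.

Lemma mem_mixed_idx b i :
  ((b, i) \in mixed_idx) = (1 <= i)%N && (if b then i <= N else i < N)%N.
Proof.
rewrite mem_cat; case: b.
  rewrite mem_map ?mem_index_iota ?ltnS; last by move=> x y [].
  by case: mapP => [[]|]//; rewrite orbF.
case: mapP => [[]|]//= _.
by rewrite mem_map ?mem_index_iota// => x y [].
Qed.

Lemma uniq_mixed_idx : uniq mixed_idx.
Proof.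
rewrite cat_uniq !map_inj_uniq ?iota_uniq/= ?andbT; try by move=> x y [].
by apply/hasPn => k /mapP[i _ ->]; apply/mapP => -[].
Qed.

Lemma big_mixed (K : comNzRingType) (P : pred (bool * nat)) (F : bool * nat -> K) :
  \prod_(k <- mixed_idx | P k) F k =
  (\prod_(1 <= i < N.+1 | P (true, i)) F (true, i)) *
  \prod_(1 <= i < N | P (false, i)) F (false, i).
Proof. by rewrite big_cat !big_map. Qed.

Lemma expansion_mixed c z : (1 < N)%N -> interlacing c ->
  (forall i, (1 <= i <= N)%N -> z != (l c i + 1)%:C) ->
  (forall i, (1 <= i < N)%N -> z != (m c i)%:C) ->
  (\prod_(1 <= i < N.+1) ((z - (l c i)%:C - th) / (z - (l c i)%:C - 1))) *
  (\prod_(1 <= i < N) ((z - (m c i)%:C + th - 1) / (z - (m c i)%:C))) =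
  1 + \sum_(1 <= i < N.+1) (resB theta N (l c) (m c) i)%:C / (z - (l c i + 1)%:C)
    + \sum_(1 <= i < N) (resD theta N (l c) (m c) i)%:C / (z - (m c i)%:C).
Proof.
move=> N1 ic hzl hzm.
have := @partial_fractions_blocked _ _
  (fun k => (mixed_zero c k)%:C) (fun k => (mixed_pole c k)%:C)
  (mixed_blocked c) mixed_idx z uniq_mixed_idx.
have -> : \prod_(k <- mixed_idx)
    ((z - (mixed_zero c k)%:C) / (z - (mixed_pole c k)%:C)) =
  (\prod_(1 <= i < N.+1) ((z - (l c i)%:C - th) / (z - (l c i)%:C - 1))) *
  (\prod_(1 <= i < N) ((z - (m c i)%:C + th - 1) / (z - (m c i)%:C))).
  rewrite big_mixed; congr (_ * _); apply: eq_bigr => i _;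
    rewrite /mixed_zero /mixed_pole/= ?(rmorphB, rmorphD) ?rmorph1/=;
    by congr (_ / _); ring.
move=> ->.
- rewrite big_cat !big_map/= addrA; congr (1 + _ + _).
    apply: eq_bigr => i _; congr (_ / _).
    rewrite big_mixed /resB !rmorphM !rmorph_prod/= mulrA -rmorphB/=.
    rewrite /mixed_zero /mixed_pole/=; congr (_%:C * _ * _); first by ring.
      apply: eq_big => [j|j _]; first by rewrite xpair_eqE.
      by rewrite real_complex_div -!rmorphB/=; congr (_%:C / _%:C); ring.
    apply: eq_bigr => j _; rewrite real_complex_div -!rmorphB/=.
    by congr (_%:C / _%:C); ring.
  apply: eq_bigr => i _; congr (_ / _).
  rewrite big_mixed /resD !rmorphM !rmorph_prod/= mulrA -rmorphB/=.
  rewrite /mixed_zero /mixed_pole/=; congr (_%:C * _ * _); first by ring.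
    apply: eq_bigr => j _; rewrite real_complex_div -!rmorphB/=.
    by congr (_%:C / _%:C); ring.
  apply: eq_big => [j|j _]; first by rewrite xpair_eqE.
  by rewrite real_complex_div -!rmorphB/=; congr (_%:C / _%:C); ring.
- move=> [[] i] [[] j]; rewrite !mem_mixed_idx /mixed_blocked/= => hi hj nb ij;
    apply/eqP => /realC_inj; rewrite /mixed_pole/=.
  + by move=> /addIr /(ell_inj ic hi hj) e; rewrite e eqxx in ij.
  + apply: ell_succ_neq_emm ic hi hj _ => i1.
    by move: nb; rewrite i1.
  + exact: emm_neq_ell_succ ic hi hj nb.
  + by move=> /(emm_inj ic hi hj) e; rewrite e eqxx in ij.
- move=> y hy; rewrite big_mixed /mixed_blocked/=.
  (* the blocked factor of [l_(i+1)] is the inverse of that of [m_i] *)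
  pose f k := (y - (mixed_zero c k)%:C) / (y - (mixed_pole c k)%:C).
  have -> : \prod_(1 <= i < N.+1 | (1 < i)%N && (lam c i == mu c i.-1)) f (true, i) =
      \prod_(1 <= i < N | lam c i.+1 == mu c i) f (true, i.+1).
    rewrite big_mkcond big_ltn; last by lia.
    rewrite /= mul1r big_add1/= [RHS]big_mkcond.
    by apply: eq_big_nat => i /andP[i1 _]; rewrite ltnS i1.
  rewrite -big_split/= big_nat_cond big1// => i /andP[hi /eqP e].
  have me : m c i = l c i.+1 + theta.
    by rewrite /emm /ell -(@step_theta R N theta i.+1 (mu c i))//; lia.
  have h1 : y != (l c i.+1 + 1)%:C.
    have := hy (true, i.+1); rewrite mem_mixed_idx /mixed_blocked /mixed_pole/= e eqxx.
    by apply => //; lia.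
  have h2 : y != (l c i.+1 + theta)%:C.
    have := hy (false, i); rewrite mem_mixed_idx /mixed_blocked /mixed_pole/= e eqxx -me.
    by apply => //; lia.
  rewrite /f /mixed_zero /mixed_pole/= me.
  have -> : l c i.+1 + theta + 1 - theta = l c i.+1 + 1 by ring.
  by rewrite mulrA divfK ?divff ?subr_eq0.
- move=> [[] i]; rewrite mem_mixed_idx /mixed_blocked /mixed_pole /mixed_zero/= => hi.
    move=> /andP[i1 /eqP e]; exists (false, i.-1); first by rewrite mem_mixed_idx; lia.
    rewrite /=; apply/eqP; congr (_%:C).
    by rewrite /emm /ell (@step_theta R N theta i _ (lam c i))// ?e//; [ring|lia].
  move=> /eqP e; exists (true, i.+1); first by rewrite mem_mixed_idx; lia.
  rewrite /=; apply/eqP; congr (_%:C).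
  by rewrite /emm /ell -(@step_theta R N theta i.+1 (mu c i))//; lia.
- move=> [[] i]; rewrite mem_mixed_idx /mixed_pole/= => hi.
    by apply: hzl; lia.
  by apply: hzm; lia.
Qed.

End ConfigPartialFractions.

(** * The first loop equation *)

Section FirstLoopEquation.
Variables (R : realType) (N M : nat) (theta : R) (w tau : R -> R[i]).
Variables (D : set R[i]^o) (phit phib phim : R[i]^o -> R[i]^o).
Hypothesis theta_gt0 : 0 < theta.
Hypothesis theta_neq1 : theta != 1.
Hypothesis N_ge2 : (2 <= N)%N.
Hypothesis D_itv : forall x : R, 0 <= x <= M%:R + 1 + N.-1%:R * theta -> D x%:C.
Hypothesis phit_an : analytic_in D phit.
Hypothesis phib_an : analytic_in D phib.
Hypothesis phim_an : analytic_in D phim.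
Hypothesis ratio_t : forall x : R, 1 <= x <= M%:R + N.-1%:R * theta ->
  phit x%:C * w x = phim x%:C * w (x - 1).
Hypothesis ratio_b : forall x : R, theta + 1 <= x <= M%:R + N.-1%:R * theta ->
  phib x%:C * tau (x - 1) = phim x%:C * tau x.
Implicit Types (c : config N M) (i j : nat).

Local Notation l := (ell theta).
Local Notation m := (emm theta).
Local Notation th := (theta%:C).
Local Notation Pr c := (prob theta w tau c).
Local Notation kappa := (th / (1 - th)).

Lemma ell_in_D c i : (1 <= i <= N)%N -> D (l c i)%:C /\ D (l c i + 1)%:C.
Proof.
have t0 := theta_gt0; move=> hi; have lM := lam_le c i.
have h1 : 0 <= (N - i)%:R * theta by rewrite mulr_ge0// ltW.
have h2 : (N - i)%:R * theta <= N.-1%:R * theta.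
  by rewrite ler_wpM2r ?(ltW t0)// ler_nat; lia.
have h3 : 0 <= (lam c i)%:R :> R by [].
rewrite -(ler_nat R) in lM.
by split; apply: D_itv; rewrite /ell; lra.
Qed.

Lemma emm_in_D c i : (1 <= i < N)%N -> D (m c i)%:C /\ D (m c i + 1)%:C.
Proof.
have t0 := theta_gt0; move=> hi; have lM := mu_le c i.
have h1 : 0 <= (N - i)%:R * theta by rewrite mulr_ge0// ltW.
have h2 : (N - i)%:R * theta <= N.-1%:R * theta.
  by rewrite ler_wpM2r ?(ltW t0)// ler_nat; lia.
have h3 : 0 <= (mu c i)%:R :> R by [].
rewrite -(ler_nat R) in lM.
by split; apply: D_itv; rewrite /emm; lra.
Qed.

(** A simultaneous choice of the removable extensions of all the difference
    quotients of [f]. *)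
Lemma slopes f : analytic_in D f ->
  exists dq : R[i]^o -> R[i]^o -> R[i]^o, forall p, D p ->
    analytic_in D (dq p) /\ forall z, z != p -> dq p z = (f z - f p) / (z - p).
Proof.
move=> f_an.
have H p : exists g : R[i]^o -> R[i]^o, D p ->
    analytic_in D g /\ forall z, z != p -> g z = (f z - f p) / (z - p).
  have [Dp|nDp] := pselect (D p); last by exists (fun=> 0).
  by have [g hg] := analytic_in_slope Dp f_an; exists g.
by have [dq hdq] := choice H; exists dq.
Qed.

(** The analytic extension of [R1] is the combination of the [phi]'s and of their
    extended difference quotients; it differs from [R1] by the residues, which
    sum to the two subtracted boundary terms. *)
Lemma R1_analytic :
  analytic_in_off D (poles1 N M theta) (R1 N M theta w tau phit phib phim).
Proof.
have [dt hdt] := slopes phit_an; have [db hdb] := slopes phib_an.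
have [dm hdm] := slopes phim_an.
pose FL c i (z : R[i]^o) : R[i]^o :=
  ((resA theta N (l c) i)%:C * Pr c) * dt (l c i)%:C z +
  (kappa * (resB theta N (l c) (m c) i)%:C * Pr c) * dm (l c i + 1)%:C z.
pose FM c i (z : R[i]^o) : R[i]^o :=
  ((resC theta N (m c) i)%:C * Pr c) * db (m c i + 1)%:C z +
  (kappa * (resD theta N (l c) (m c) i)%:C * Pr c) * dm (m c i)%:C z.
pose F0 c (z : R[i]^o) : R[i]^o := Pr c * phit z + (Pr c * phib z + (kappa * Pr c) * phim z).
pose Fc c (z : R[i]^o) : R[i]^o := F0 c z +
  ((\sum_(1 <= i < N.+1 | (1 <= i <= N)%N) FL c i z) +
    \sum_(1 <= i < N | (1 <= i < N)%N) FM c i z).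
exists (fun z => \sum_(c : config N M | interlacing c) Fc c z); split.
  apply: analytic_in_sum => c ic; apply: analytic_inD.
    exact: (analytic_inD (analytic_inZ _ phit_an)
      (analytic_inD (analytic_inZ _ phib_an) (analytic_inZ _ phim_an))).
  apply: analytic_inD; apply: analytic_in_sum => i hi; apply: analytic_inD;
    apply: analytic_inZ.
  - by apply: (proj1 (hdt _ _)); apply: (proj1 (ell_in_D c hi)).
  - by apply: (proj1 (hdm _ _)); apply: (proj2 (ell_in_D c hi)).
  - by apply: (proj1 (hdb _ _)); apply: (proj2 (emm_in_D c hi)).
  - by apply: (proj1 (hdm _ _)); apply: (proj1 (emm_in_D c hi)).
move=> z Dz npole.
have z0 : z != 0 by apply/eqP => e; apply: npole; left.
have zs : z != (sN N M theta)%:C by apply/eqP => e; apply: npole; right; left.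
have zl c i : interlacing c -> (1 <= i <= N)%N -> z != (l c i)%:C /\ z != (l c i + 1)%:C.
  move=> ic hi; split; apply/eqP => e; apply: npole; right; right; exists c => //; left;
    exists i => //; first [by left | by right].
have zm c i : interlacing c -> (1 <= i < N)%N -> z != (m c i)%:C /\ z != (m c i + 1)%:C.
  move=> ic hi; have hi' : (1 <= i <= N.-1)%N by lia.
  split; apply/eqP => e; apply: npole; right; right; exists c => //; right;
    exists i => //; first [by left | by right].
(* the test function for which the tested residues are the polar parts of [R1 z] *)
pose h (p : R[i]) : R[i] := (z - p)^-1.
have split_slope (A P x y d : R[i]) :
    A * P * ((x - y) / d) + A * P * y * d^-1 = A / d * (x * P).
  by move: d^-1 => e; ring.
have split_slopek (k A P x y d : R[i]) :
    k * A * P * ((x - y) / d) + k * A * P * y * d^-1 = A / d * (k * x * P).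
  by move: d^-1 => e; ring.
pose tA i c := termA theta w tau phit h i c; pose tB i c := termB theta w tau phim h i c.
pose tC i c := termC theta w tau phib h i c; pose tD i c := termD theta w tau phim h i c.
have perc c : interlacing c ->
    phit z * ((\prod_(1 <= i < N.+1) ((z - (l c i)%:C - th) / (z - (l c i)%:C))) * Pr c) +
    phib z * ((\prod_(1 <= i < N) ((z - (m c i)%:C + th - 1) / (z - (m c i)%:C - 1))) * Pr c) +
    kappa * phim z *
     ((\prod_(1 <= i < N.+1) ((z - (l c i)%:C - th) / (z - (l c i)%:C - 1))) *
      (\prod_(1 <= i < N) ((z - (m c i)%:C + th - 1) / (z - (m c i)%:C))) * Pr c) =
    Fc c z + (\sum_(1 <= i < N.+1) (tA i c + tB i c) +
              \sum_(1 <= i < N) (tC i c + tD i c)).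
  move=> ic.
  rewrite (expansion_top theta_gt0 ic); last by move=> i hi; case: (zl c i ic hi).
  rewrite (expansion_bottom theta_gt0 ic); last by move=> i hi; case: (zm c i ic hi).
  rewrite (expansion_mixed theta_gt0 N_ge2 ic); last 2 first.
  - by move=> i hi; case: (zl c i ic hi).
  - by move=> i hi; case: (zm c i ic hi).
  have eL : (\sum_(1 <= i < N.+1 | (1 <= i <= N)%N) FL c i z) +
      \sum_(1 <= i < N.+1) (tA i c + tB i c) =
      (\sum_(1 <= i < N.+1) (resA theta N (l c) i)%:C / (z - (l c i)%:C)) * (phit z * Pr c) +
      (\sum_(1 <= i < N.+1) (resB theta N (l c) (m c) i)%:C / (z - (l c i + 1)%:C)) *
        (kappa * phim z * Pr c).
    rewrite !big_distrl/= -big_split/= -big_nat -big_split/=.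
    apply: eq_big_nat => i hi; have [h1 h2] := zl c i ic hi.
    have [d1 d2] := ell_in_D c hi.
    rewrite /FL (proj2 (hdt _ d1) z h1) (proj2 (hdm _ d2) z h2) addrACA.
    by congr (_ + _); [exact: split_slope|exact: split_slopek].
  have eM : (\sum_(1 <= i < N | (1 <= i < N)%N) FM c i z) +
      \sum_(1 <= i < N) (tC i c + tD i c) =
      (\sum_(1 <= i < N) (resC theta N (m c) i)%:C / (z - (m c i + 1)%:C)) * (phib z * Pr c) +
      (\sum_(1 <= i < N) (resD theta N (l c) (m c) i)%:C / (z - (m c i)%:C)) *
        (kappa * phim z * Pr c).
    rewrite !big_distrl/= -big_split/= -big_nat -big_split/=.
    apply: eq_big_nat => i hi; have [h1 h2] := zm c i ic hi.
    have [d1 d2] := emm_in_D c hi.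
    rewrite /FM (proj2 (hdb _ d2) z h2) (proj2 (hdm _ d1) z h1) addrACA.
    by congr (_ + _); [exact: split_slope|exact: split_slopek].
  rewrite /Fc -[RHS]addrA [X in _ = _ + X]addrACA eL eM /F0.
  move: (\sum_(1 <= i < N.+1) _ / _) (\sum_(1 <= i < N.+1) _ / _) => a b.
  move: (\sum_(1 <= i < N) _ / _) (\sum_(1 <= i < N) _ / _) => a' b'.
  move: (prob _ _ _ _) (phit z) (phib z) (phim z) kappa => p x1 x2 x3 k.
  by ring.
have total := residue_sum h theta_gt0 theta_neq1 N_ge2 ratio_t ratio_b.
rewrite -addrA boundary_ellN// boundary_ell1_m1// in total.
rewrite exchange_big/= [X in _ + X = _]exchange_big/= -big_split/= in total.
rewrite /R1 /expect !mulr_sumr -!big_split/= (eq_bigr _ perc) [in RHS]big_split/=.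
rewrite [X in _ = _ + X - _ - _](_ : _ = r1_minus N M theta w tau phit * h 0 +
  r1_plus N M theta w tau phib phim * h (sN N M theta)%:C); last exact: total.
rewrite /h subr0.
move: (_ / z) (_ / (z - _)) (\sum_(_ | _) _) => a b e.
by ring.
Qed.

End FirstLoopEquation.

(** * Reversal of products and weights *)

Section ReversedProducts.
Variable K : comNzRingType.

Lemma prod_nat_reflect (F : nat -> K) k a b : (a <= b)%N -> (b <= k.+1)%N ->
  \prod_(a <= i < b) F (k - i)%N = \prod_(k.+1 - b <= j < k.+1 - a) F j.
Proof.
move=> ab; rewrite -(subnKC ab); elim: (b - a)%N => [|d IHd] bk.
  by rewrite addn0 !big_geq.
rewrite addnS big_nat_recr ?leq_addr//= IHd; last by lia.
rewrite mulrC [RHS]big_ltn; last by lia.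
by have -> : (k.+1 - (a + d).+1).+1 = (k.+1 - (a + d))%N by lia.
Qed.

Lemma prod_pair_reflect (G : nat -> nat -> K) (r : rel nat) n :
  (forall p q, (1 <= p < n)%N -> (1 <= q < n)%N -> r (n - q)%N (n - p)%N = r p q) ->
  \prod_(1 <= p < n) \prod_(1 <= q < n | r p q) G p q =
  \prod_(1 <= p < n) \prod_(1 <= q < n | r p q) G (n - q)%N (n - p)%N.
Proof.
move=> hr; have [n1|n1] := leqP n 1; first by rewrite !big_geq.
have refl (F : nat -> K) : \prod_(1 <= i < n) F i = \prod_(1 <= i < n) F (n - i)%N.
  rewrite prod_nat_reflect//; last by lia.
  by rewrite subSnn subSS subn0.
rewrite refl; under eq_bigr do rewrite big_mkcond refl.
rewrite exchange_big/=; apply: eq_big_nat => q hq.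
rewrite [RHS]big_mkcond; apply: eq_big_nat => p hp.
by rewrite hr.
Qed.

(** The reversal [(p, q) -> (n - b, n + 1 - a)] turns strict inequalities into
    large ones, which exchanges the two products mixing [l] and [m]. *)
Lemma prod_pair_reflect_mixed (G : nat -> nat -> K) n :
  \prod_(1 <= p < n.+1) \prod_(1 <= q < n.+1 | (p < q)%N) G p q =
  \prod_(1 <= p < n) \prod_(1 <= q < n | (p <= q)%N) G (n - q)%N (n.+1 - p)%N.
Proof.
transitivity (\prod_(1 <= p < n) \prod_(1 <= q < n | (p <= q)%N) G p q.+1).
  case: n => [|n]; first by rewrite !big_geq.
  rewrite big_nat_recr//= [X in _ * X]big_nat_cond [X in _ * X]big1; last by move=> q; lia.
  rewrite mulr1; apply: eq_big_nat => p hp.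
  rewrite big_mkcond big_ltn//= ifN; last by lia.
  by rewrite mul1r big_add1 [RHS]big_mkcond.
rewrite (@prod_pair_reflect (fun p q => G p q.+1) leq); last by move=> p q; lia.
apply: eq_big_nat => p hp; apply: eq_bigr => q _.
by congr (G _ _); lia.
Qed.

End ReversedProducts.

Section ReflectedWeights.
Variables (R : realFieldType) (theta k : R) (g : R -> R).

Lemma red_weight_reflect N (l l' m m' : nat -> R) :
  (forall p, (1 <= p <= N)%N -> l' p = k - l (N.+1 - p)%N) ->
  (forall p, (1 <= p < N)%N -> m' p = k + theta - m (N - p)%N) ->
  red_weight theta g N l' m' = red_weight theta g N l m.
Proof.
move=> hl hm; rewrite /red_weight.
have -> : \prod_(1 <= p < N.+1) \prod_(1 <= q < N.+1 | (p < q)%N) (l' p - l' q) =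
    \prod_(1 <= p < N.+1) \prod_(1 <= q < N.+1 | (p < q)%N) (l p - l q).
  rewrite [RHS](@prod_pair_reflect _ (fun p q => l p - l q) ltn);
    last by move=> p q /=; lia.
  apply: eq_big_nat => p hp; rewrite big_nat_cond [RHS]big_nat_cond.
  apply: eq_bigr => q /andP[hq _]; rewrite !hl; [ring|lia|lia].
have -> : \prod_(1 <= p < N) \prod_(1 <= q < N | (p < q)%N) (m' p - m' q) =
    \prod_(1 <= p < N) \prod_(1 <= q < N | (p < q)%N) (m p - m q).
  rewrite [RHS](@prod_pair_reflect _ (fun p q => m p - m q) ltn);
    last by move=> p q /=; lia.
  apply: eq_big_nat => p hp; rewrite big_nat_cond [RHS]big_nat_cond.
  apply: eq_bigr => q /andP[hq _]; rewrite !hm; [ring|lia|lia].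
have -> : \prod_(1 <= p < N.+1) \prod_(1 <= q < N.+1 | (p < q)%N) g (m' p - l' q) =
    \prod_(1 <= p < N) \prod_(1 <= q < N | (p <= q)%N) g (l p - m q + theta).
  rewrite prod_pair_reflect_mixed.
  apply: eq_big_nat => p hp; rewrite big_nat_cond [RHS]big_nat_cond.
  apply: eq_bigr => q /andP[hq pq]; rewrite hl ?hm; [|lia|lia].
  have -> : (N - (N - q) = q)%N by lia.
  have -> : (N.+1 - (N.+1 - p) = p)%N by lia.
  by congr (g _); ring.
have -> : \prod_(1 <= p < N) \prod_(1 <= q < N | (p <= q)%N) g (l' p - m' q + theta) =
    \prod_(1 <= p < N.+1) \prod_(1 <= q < N.+1 | (p < q)%N) g (m p - l q).
  rewrite prod_pair_reflect_mixed.
  apply: eq_big_nat => p hp; rewrite big_nat_cond [RHS]big_nat_cond.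
  apply: eq_bigr => q /andP[hq pq]; rewrite hl ?hm; [|lia|lia].
  by congr (g _); ring.
by rewrite -!mulrA; congr (_ * (_ * _)); rewrite mulrC.
Qed.

End ReflectedWeights.

(** * The reflection exchanging the two loop equations *)

Lemma nbhs_reflect (K : numFieldType) (s z0 : K^o) (P : set K^o) :
  nbhs (s - z0) P -> nbhs z0 (fun z : K^o => P (s - z)).
Proof.
move=> /nbhs_ballP[e e0 he]; apply/nbhs_ballP; exists e => // z hz.
apply: he; rewrite /ball/= in hz *.
have -> : s - z0 - (s - z) = - (z0 - z) by ring.
by rewrite normrN.
Qed.

Lemma analytic_in_reflect (R : realType) (D : set R[i]^o) (f : R[i]^o -> R[i]^o)
    (s : R[i]^o) :
  analytic_in D f -> analytic_in (fun z => D (s - z)) (fun z => f (s - z)).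
Proof.
move=> hf z0 Dz0; have [a ha] := hf _ Dz0.
exists (fun k => (-1) ^+ k * a k); apply: nbhsS (nbhs_reflect ha) => z h.
have -> : (fun n => \sum_(0 <= k < n) (-1) ^+ k * a k * (z - z0) ^+ k) =
    (fun n => \sum_(0 <= k < n) a k * (s - z - (s - z0)) ^+ k); last exact: h.
apply/funext => n; apply: eq_bigr => k _.
have -> : s - z - (s - z0) = - (z - z0) by ring.
by rewrite [in RHS]exprNn mulrA [a k * _]mulrC.
Qed.

Section Reflection.
Variables (R : realType) (N M : nat) (theta : R) (w tau : R -> R[i]).
Hypothesis theta_gt0 : 0 < theta.
Hypothesis N_ge2 : (2 <= N)%N.
Implicit Types (c : config N M) (i j : nat).

Local Notation l := (ell theta).
Local Notation m := (emm theta).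
Local Notation th := (theta%:C).
Local Notation s := (sN N M theta).

(** The configuration read backwards: [lambda_i] becomes
    [M - lambda_(N+1-i)] and [mu_i] becomes [M - mu_(N-i)], hence [l_i] becomes
    [s_N - 1 - l_(N+1-i)] and [m_i] becomes [s_N - 1 + theta - m_(N-i)]. *)
Definition reverse c : config N M :=
  ([tuple rev_ord (tnth c.1 (rev_ord j)) | j < N],
   [tuple rev_ord (tnth c.2 (rev_ord j)) | j < N.-1]).

(** The weights for which the reversed configuration has the original weight. *)
Definition w_reverse (x : R) : R[i] := w (s - 1 - x).
Definition tau_reverse (x : R) : R[i] := tau (s - 1 + theta - x).

Lemma lam_reverse c i : (1 <= i <= N)%N -> lam (reverse c) i = (M - lam c (N.+1 - i))%N.
Proof.
move=> hi; have iN : (i.-1 < N)%N by lia.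
rewrite /lam /reverse/= (nth_mktuple _ _ (Ordinal iN))/= (tnth_nth ord0)/= subSS.

by congr (_ - nat_of_ord (nth _ _ _))%N; lia.
Qed.

Lemma mu_reverse c i : (1 <= i < N)%N -> mu (reverse c) i = (M - mu c (N - i))%N.
Proof.
move=> hi; have iN : (i.-1 < N.-1)%N by lia.
rewrite /mu /reverse/= (nth_mktuple _ _ (Ordinal iN))/= (tnth_nth ord0)/= subSS.
by congr (_ - nat_of_ord (nth _ _ _))%N; lia.
Qed.

Lemma reverseK : involutive reverse.
Proof.
move=> c; apply: config_eq => j hj.
  rewrite !lam_reverse//; last by lia.
  have -> : (N.+1 - (N.+1 - j) = j)%N by lia.
  by have := lam_le c j; lia.
rewrite !mu_reverse//; last by lia.
have -> : (N - (N - j) = j)%N by lia.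
by have := mu_le c j; lia.
Qed.

Lemma interlacing_reverse c : interlacing (reverse c) = interlacing c.
Proof.
suff imp d : interlacing d -> interlacing (reverse d).
  by apply/idP/idP => [/imp|/imp//]; rewrite reverseK.
move=> /interlacingP h; apply/interlacingP => k hk.
rewrite !lam_reverse ?mu_reverse; try lia.
have -> : (N.+1 - k.+1 = N - k)%N by lia.
have -> : (N.+1 - k = (N - k).+1)%N by lia.
have := h (N - k)%N; have := lam_le d (N - k); have := lam_le d (N - k).+1.
have := mu_le d (N - k); lia.
Qed.

Lemma ell_reverse c i : (1 <= i <= N)%N -> l (reverse c) i = s - 1 - l c (N.+1 - i)%N.
Proof.
move=> hi; rewrite /ell /sN lam_reverse// natrB ?lam_le//.
have -> : (N.-1 = (N - i) + (N - (N.+1 - i)))%N by lia.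
by rewrite natrD; ring.
Qed.

Lemma emm_reverse c i : (1 <= i < N)%N -> m (reverse c) i = s - 1 + theta - m c (N - i)%N.
Proof.
move=> hi; rewrite /emm /sN mu_reverse// natrB ?mu_le//.
have e : N.-1%:R + 1 = (N - i)%:R + (N - (N - i))%:R :> R.
  by rewrite -natrD natr1; congr (_%:R); lia.
have -> : M%:R + 1 + N.-1%:R * theta - 1 + theta = M%:R + (N.-1%:R + 1) * theta by ring.
by rewrite e; ring.
Qed.

Lemma prod_ell_reverse (A : comNzRingType) (f : R -> A) c a b :
  (1 <= a)%N -> (a <= b)%N -> (b <= N.+1)%N ->
  \prod_(a <= i < b) f (l (reverse c) i) =
  \prod_(N.+2 - b <= i < N.+2 - a) f (s - 1 - l c i).
Proof.
move=> a1 ab bN; rewrite -(prod_nat_reflect (fun i => f (s - 1 - l c i)))//; last by lia.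
by apply: eq_big_nat => i hi; rewrite ell_reverse//; lia.
Qed.

Lemma prod_emm_reverse (A : comNzRingType) (f : R -> A) c a b :
  (1 <= a)%N -> (a <= b)%N -> (b <= N)%N ->
  \prod_(a <= i < b) f (m (reverse c) i) =
  \prod_(N.+1 - b <= i < N.+1 - a) f (s - 1 + theta - m c i).
Proof.
move=> a1 ab bN; rewrite -(prod_nat_reflect (fun i => f (s - 1 + theta - m c i)))//;
  last by lia.
by apply: eq_big_nat => i hi; rewrite emm_reverse//; lia.
Qed.

Lemma weight_reverse c : interlacing c ->
  weight theta w_reverse tau_reverse (reverse c) = weight theta w tau c.
Proof.
move=> ic; have ic' : interlacing (reverse c) by rewrite interlacing_reverse.
rewrite (weightE w tau theta_gt0 ic) (weightE w_reverse tau_reverse theta_gt0 ic').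
rewrite (@red_weight_reflect _ theta (s - 1) _ N (l c) _ (m c)); last 2 first.
- by move=> p hp; exact: ell_reverse.
- by move=> p hp; exact: emm_reverse.
rewrite prod_ell_reverse// prod_emm_reverse//; try lia.
have -> : (N.+2 - N.+1 = 1)%N by lia.
have -> : (N.+2 - 1 = N.+1)%N by lia.
have -> : (N.+1 - N = 1)%N by lia.
have -> : (N.+1 - 1 = N)%N by lia.
congr (_ * _ * _); apply: eq_bigr => i _; rewrite /w_reverse /tau_reverse subKr//.
Qed.

Lemma ZN_reverse : ZN N M theta w_reverse tau_reverse = ZN N M theta w tau.
Proof.
rewrite /ZN (reindex_inj (inv_inj reverseK))/=.
by apply: eq_big => [c|c ic]; [exact: interlacing_reverse|rewrite weight_reverse// -interlacing_reverse].
Qed.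

Lemma expect_reverse (F : config N M -> R[i]) :
  expect theta w_reverse tau_reverse F = expect theta w tau (fun c => F (reverse c)).
Proof.
rewrite /expect (reindex_inj (inv_inj reverseK))/=.
apply: eq_big => [c|c ic]; first exact: interlacing_reverse.
by rewrite /prob ZN_reverse weight_reverse// -interlacing_reverse.
Qed.

Lemma eq_expect (F G : config N M -> R[i]) : (forall c, F c = G c) ->
  expect theta w tau F = expect theta w tau G.
Proof. by move=> FG; apply: eq_bigr => c _; rewrite FG. Qed.

Variables (phit phib phim : R[i]^o -> R[i]^o).
Local Notation refl f := (fun z : R[i]^o => f (s%:C - z)).
Local Notation C x := (x%:C).

Lemma eq_expect_on (A B : pred (config N M)) (F G : config N M -> R[i]) :
  (forall c, A (reverse c) = B c) -> (forall c, F (reverse c) = G c) ->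
  expect_on theta w_reverse tau_reverse A F = expect_on theta w tau B G.
Proof.
by move=> AB FG; rewrite /expect_on expect_reverse; apply: eq_expect => c; rewrite AB FG.
Qed.

Lemma ellN_is0_reverse c : ellN_is0 theta (reverse c) = ell1_is_max theta c.
Proof.
rewrite /ellN_is0 /ell1_is_max ell_reverse ?subSnn; [|lia].
by rewrite subr_eq0 eq_sym.
Qed.

Lemma ell1_is_max_reverse c : ell1_is_max theta (reverse c) = ellN_is0 theta c.
Proof.
rewrite /ellN_is0 /ell1_is_max ell_reverse; [|lia].
by rewrite subSS subn0 -subr_eq0 addrAC subrr sub0r oppr_eq0.
Qed.

Lemma m1_is_max_reverse c : m1_is_max theta (reverse c) = mlast_is_theta theta c.
Proof.
rewrite /m1_is_max /mlast_is_theta emm_reverse; [|lia].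
by rewrite subn1 -subr_eq0 addrAC [s - 1 + _]addrC addrK subr_eq0 eq_sym.
Qed.

Lemma div_opp (x y x' y' : R[i]) : x = - x' -> y = - y' -> x / y = x' / y'.
Proof. by move=> -> ->; rewrite invrN mulrNN. Qed.

Let cl (x : R) : C (s - 1 - x) = C s - 1 - C x.
Proof. by rewrite !rmorphB rmorph1. Qed.

Let cm (x : R) : C (s - 1 + theta - x) = C s - 1 + th - C x.
Proof. by rewrite rmorphB rmorphD rmorphB rmorph1. Qed.

Lemma r1_minus_reverse : r1_minus N M theta w_reverse tau_reverse (refl phit) =
  - r2_plus N M theta w tau phit.
Proof.
rewrite /r1_minus /r2_plus subr0 (eq_expect_on ellN_is0_reverse
  (G := fun c => \prod_(2 <= i < N.+1) ((C s - C (l c i) + th - 1) / (C s - C (l c i) - 1)))).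
  by rewrite mulrN mulNr.
move=> c; rewrite (prod_ell_reverse (fun x => (C x + th) / C x)); try lia.
have -> : (N.+2 - N = 2)%N by lia.
have -> : (N.+2 - 1 = N.+1)%N by lia.
by apply: eq_bigr => i _ /=; rewrite cl; congr (_ / _); ring.
Qed.

Lemma r1_plus_reverse : r1_plus N M theta w_reverse tau_reverse (refl phib) (refl phim) =
  - r2_minus N M theta w tau phib phim.
Proof.
rewrite /r1_plus /r2_minus subrr.
rewrite (eq_expect_on ell1_is_max_reverse
  (G := fun c => (\prod_(1 <= i < N) ((C (l c i) - th + 1) / C (l c i))) *
     \prod_(1 <= i < N) (C (m c i) / (C (m c i) - th + 1)))); last first.
  move=> c; congr (_ * _).
    rewrite (prod_ell_reverse (fun x => (C s - C x - th) / (C s - C x - 1))); try lia.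
    have -> : (N.+2 - N.+1 = 1)%N by lia.
    have -> : (N.+2 - 2 = N)%N by lia.
    by apply: eq_bigr => i _ /=; rewrite cl; congr (_ / _); ring.
  rewrite (prod_emm_reverse (fun x => (C s - C x + th - 1) / (C s - C x))); try lia.
  have -> : (N.+1 - N = 1)%N by lia.
  have -> : (N.+1 - 1 = N)%N by lia.
  by apply: eq_bigr => i _ /=; rewrite cm; congr (_ / _); ring.
rewrite (eq_expect_on m1_is_max_reverse
  (G := fun c => \prod_(1 <= i < N.-1) (C (m c i) / (C (m c i) - th)))); last first.
  move=> c.
  rewrite (prod_emm_reverse (fun x => (C s - C x + th - 1) / (C s - C x - 1))); try lia.
  have -> : (N.+1 - N = 1)%N by lia.
  have -> : (N.+1 - 2 = N.-1)%N by lia.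
  by apply: eq_bigr => i _ /=; rewrite cm; congr (_ / _); ring.
move: (expect_on _ _ _ _ _) (expect_on _ _ _ _ _) (phib _) (phim _) => a b d e.
by ring.
Qed.

Lemma R1_reverse z :
  R1 N M theta w_reverse tau_reverse (refl phit) (refl phib) (refl phim) (s%:C - z) =
  R2 N M theta w tau phit phib phim z.
Proof.
rewrite /R1 /R2 !expect_reverse subKr r1_minus_reverse r1_plus_reverse.
have r1 : (N.+2 - N.+1 = 1)%N by lia.
have r2 : (N.+2 - 1 = N.+1)%N by lia.
have r3 : (N.+1 - N = 1)%N by lia.
have r4 : (N.+1 - 1 = N)%N by lia.
rewrite (@eq_expect _ (fun c => \prod_(1 <= i < N.+1)
    ((z - C (l c i) + th - 1) / (z - C (l c i) - 1)))); last first.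
  move=> c; rewrite (prod_ell_reverse (fun x => (C s - z - C x - th) / (C s - z - C x))); try lia.
  by rewrite r1 r2; apply: eq_bigr => i _ /=; rewrite cl; apply: div_opp; ring.
rewrite (@eq_expect (fun c => \prod_(1 <= i < N)
    ((C s - z - C (m (reverse c) i) + th - 1) / (C s - z - C (m (reverse c) i) - 1)))
  (fun c => \prod_(1 <= i < N) ((z - C (m c i)) / (z - C (m c i) + th)))); last first.
  move=> c; rewrite (prod_emm_reverse (fun x => (C s - z - C x + th - 1) / (C s - z - C x - 1)));
    try lia.
  by rewrite r3 r4; apply: eq_bigr => i _ /=; rewrite cm; apply: div_opp; ring.
rewrite (@eq_expect (fun c => (\prod_(1 <= i < N.+1)
     ((C s - z - C (l (reverse c) i) - th) / (C s - z - C (l (reverse c) i) - 1))) *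
     \prod_(1 <= i < N)
     ((C s - z - C (m (reverse c) i) + th - 1) / (C s - z - C (m (reverse c) i))))
  (fun c => (\prod_(1 <= i < N.+1) ((z - C (l c i) + th - 1) / (z - C (l c i)))) *
     \prod_(1 <= i < N) ((z - C (m c i)) / (z - C (m c i) + th - 1)))); last first.
  move=> c; congr (_ * _).
    rewrite (prod_ell_reverse (fun x => (C s - z - C x - th) / (C s - z - C x - 1))); try lia.
    by rewrite r1 r2; apply: eq_bigr => i _ /=; rewrite cl; apply: div_opp; ring.
  rewrite (prod_emm_reverse (fun x => (C s - z - C x + th - 1) / (C s - z - C x))); try lia.
  by rewrite r3 r4; apply: eq_bigr => i _ /=; rewrite cm; apply: div_opp; ring.
rewrite -[LHS]addrA -[RHS]addrA; congr (_ + _).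
have -> : - (- r2_plus N M theta w tau phit / (C s - z)) =
    - (r2_plus N M theta w tau phit / (z - C s)).
  by rewrite -[C s - z]opprB invrN mulrNN.
have -> : - (- r2_minus N M theta w tau phib phim / (C s - z - C s)) =
    - (r2_minus N M theta w tau phib phim / z).
  by rewrite addrAC subrr sub0r invrN mulrNN.
by rewrite addrC.
Qed.

Lemma poles1_reverse z : poles1 N M theta (s%:C - z) -> poles2 N M theta z.
Proof.
move=> [e|[e|[c ic [[i hi [e|e]]|[i hi [e|e]]]]]].
- by right; left; apply/esym/eqP; rewrite -subr_eq0 e.
- left; apply/eqP; rewrite -oppr_eq0 -(subrK s%:C z) opprD opprB e.
  by rewrite subrr.
- right; right; exists (reverse c); first by rewrite interlacing_reverse.
  left; exists (N.+1 - i)%N; first by lia.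
  right; rewrite ell_reverse; last by lia.
  have -> : (N.+1 - (N.+1 - i) = i)%N by lia.
  by rewrite -[LHS](subKr s%:C) e addrAC subrK rmorphB.
- right; right; exists (reverse c); first by rewrite interlacing_reverse.
  left; exists (N.+1 - i)%N; first by lia.
  left; rewrite ell_reverse; last by lia.
  have -> : (N.+1 - (N.+1 - i) = i)%N by lia.
  by rewrite -[LHS](subKr s%:C) e -rmorphB/=; congr (_%:C); ring.
- right; right; exists (reverse c); first by rewrite interlacing_reverse.
  right; exists (N - i)%N; first by lia.
  right; rewrite emm_reverse; last by lia.
  have -> : (N - (N - i) = i)%N by lia.
  by rewrite -[LHS](subKr s%:C) e -rmorphB/=; congr (_%:C); ring.
- right; right; exists (reverse c); first by rewrite interlacing_reverse.
  right; exists (N - i)%N; first by lia.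
  left; rewrite emm_reverse; last by lia.
  have -> : (N - (N - i) = i)%N by lia.
  by rewrite -[LHS](subKr s%:C) e -rmorphB/=; congr (_%:C); ring.
Qed.
End Reflection.

(** * Both loop equations *)

(** The hypotheses on the ratios, with quotients by zero equal to zero, imply that
    no denominator vanishes. *)
Lemma cross_mul (K : fieldType) (a b c d : K) : c != 0 -> d != 0 ->
  a / b = c / d -> a * d = b * c.
Proof.
move=> c0 d0 e; have b0 : b != 0.
  apply: contraNneq (mulf_neq0 c0 (invr_neq0 d0)) => b0.
  by rewrite -e b0 invr0 mulr0.
by rewrite -[a](divfK b0) e; field.
Qed.

Theorem theorem2p1 (R : realType) (theta : R) (N M : nat)
  (w tau : R -> R[i]) (D : set R[i]^o)
  (phit1 phib1 phim1 phit2 phib2 phim2 : R[i]^o -> R[i]^o)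
  (theta_gt0 : 0 < theta) (theta_neq1 : theta != 1)
  (M_ge1 : (1 <= M)%N) (N_ge2 : (2 <= N)%N)
  (w_neq0 : forall x : R, 0 <= x <= M%:R + N.-1%:R * theta -> w x != 0)
  (tau_neq0 : forall x : R,
     theta <= x <= M%:R + N.-1%:R * theta -> tau x != 0)
  (ZN_neq0 : ZN N M theta w tau != 0)
  (D_open : open D)
  (D_itv : forall x : R, 0 <= x <= M%:R + 1 + N.-1%:R * theta -> D x%:C)
  (phit1_an : analytic_in D phit1) (phib1_an : analytic_in D phib1)
  (phim1_an : analytic_in D phim1) (phit2_an : analytic_in D phit2)
  (phib2_an : analytic_in D phib2) (phim2_an : analytic_in D phim2)
  (ratio_t1 : forall x : R, 1 <= x <= M%:R + N.-1%:R * theta ->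
     phit1 x%:C / phim1 x%:C = w (x - 1) / w x)
  (ratio_b1 : forall x : R, theta + 1 <= x <= M%:R + N.-1%:R * theta ->
     phib1 x%:C / phim1 x%:C = tau x / tau (x - 1))
  (ratio_t2 : forall x : R, 1 <= x <= M%:R + N.-1%:R * theta ->
     phit2 x%:C / phim2 x%:C = w x / w (x - 1))
  (ratio_b2 : forall x : R, theta + 1 <= x <= M%:R + N.-1%:R * theta ->
     phib2 (x - theta)%:C / phim2 (x - theta)%:C = tau (x - 1) / tau x) :
  analytic_in_off D (poles1 N M theta)
    (R1 N M theta w tau phit1 phib1 phim1) /\
  analytic_in_off D (poles2 N M theta)
    (R2 N M theta w tau phit2 phib2 phim2).
Proof.
have w01 (x : R) : 1 <= x <= M%:R + N.-1%:R * theta -> w x != 0 /\ w (x - 1) != 0.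
  by move=> hx; split; apply: w_neq0; move: hx theta_gt0; clear; lra.
have tau01 (x : R) : theta + 1 <= x <= M%:R + N.-1%:R * theta ->
    tau x != 0 /\ tau (x - 1) != 0.
  by move=> hx; split; apply: tau_neq0; move: hx theta_gt0; clear; lra.
split.
  apply: R1_analytic => // x hx.
    by have [h1 h2] := w01 x hx; exact: cross_mul h2 h1 (ratio_t1 x hx).
  by have [h1 h2] := tau01 x hx; exact: cross_mul h1 h2 (ratio_b1 x hx).
(* [R2] is the reflection at [s_N / 2] of an expression [R1], built from reflected
   data that satisfy the same hypotheses *)
pose s := sN N M theta.
pose refl (f : R[i]^o -> R[i]^o) : R[i]^o -> R[i]^o := fun z => f (s%:C - z).
have [F [F_an FE]] : analytic_in_off (fun z : R[i]^o => D (s%:C - z)) (poles1 N M theta)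
    (R1 N M theta (w_reverse N M theta w) (tau_reverse N M theta tau)
       (refl phit2) (refl phib2) (refl phim2)).
  apply: R1_analytic => //.
  - move=> x hx; rewrite -rmorphB/=; apply: D_itv.
    by rewrite /s /sN; move: hx; clear; lra.
  - exact: analytic_in_reflect.
  - exact: analytic_in_reflect.
  - exact: analytic_in_reflect.
  - move=> x hx; rewrite /refl -rmorphB/= /w_reverse -/s.
    have hx' : 1 <= s - x <= M%:R + N.-1%:R * theta.
      by rewrite /s /sN; move: hx; clear; lra.
    have [h1 h2] := w01 _ hx'; have := cross_mul h1 h2 (ratio_t2 _ hx').
    have -> : s - 1 - x = s - x - 1 by ring.
    by have -> : s - 1 - (x - 1) = s - x by ring.
  - move=> x hx; rewrite /refl -rmorphB/= /tau_reverse -/s.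
    have hx' : theta + 1 <= s - x + theta <= M%:R + N.-1%:R * theta.
      by rewrite /s /sN; move: hx; clear; lra.
    have [h1 h2] := tau01 _ hx'; have := cross_mul h2 h1 (ratio_b2 _ hx').
    rewrite addrK; have -> : s - 1 + theta - (x - 1) = s - x + theta by ring.
    by have -> : s - 1 + theta - x = s - x + theta - 1 by ring.
exists (fun z => F (s%:C - z)); split.
  have -> : D = (fun z : R[i]^o => D (s%:C - (s%:C - z))).
    by apply/funext => z; rewrite subKr.
  exact: analytic_in_reflect F_an.
move=> z Dz npole; rewrite FE ?subKr//; first exact: R1_reverse.
by move=> /(poles1_reverse theta_gt0 N_ge2).
Qed.
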